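(* Any connected R-graph $G$ of $B_2$-type takes the form $K(H,A)$, where $H$ and $A$ are the lengths of the red string and of the green string, respectively, emanating from the source vertex (minimal vertex, with no incoming edges) of $G$. That is, the view from the sky $\hat G$ is isomorphic, as a digraph with labels on edges and vertices, to $\hat K(H,A)$.
   Context: Let $G=(V,A_1\sqcup A_2)$ be a digraph whose edges are colored: edges in $A_1$ are ''red'' (color 1), edges in $A_2$ are ''green'' (color 2). ''Connected'' means weakly connected. $G$ is an *R-graph of $B_2$-type* if the following axioms (K0)–(K5) hold. (K0) For $i=1,2$, each weakly connected component of $(V,A_i)$ is a finite simple directed path $(v_0,e_1,v_1,\dots,e_k,v_k)$ ($v_j$ distinct, $e_j$ going from $v_{j-1}$ to $v_j$; $k=0$ allowed). These are called $i$-strings (red strings for $i=1$, green strings for $i=2$); the $i$-string through $v$ is $P_i(v)$. Let $t_i(v)$ be the number of edges of $P_i(v)$ before $v$ and $h_i(v)$ the number of edges after $v$. If color-$i$ edge $(x,y)$ exists, write $y=F_i x$, $x=E_i y$ (so $F_i$, $E_i$ are partial, mutually inverse maps). (K1) If $y=F_1x$ then $t_2(x)-t_2(y)+h_2(y)-h_2(x)=1$. If $q=F_2p$ then $t_1(p)-t_1(q)+h_1(q)-h_1(p)=2$. (K2) If $y=F_1x$ then $t_2(x)-t_2(y)\ge0$ and $h_2(y)-h_2(x)\ge 0$. If $q=F_2p$ then $t_1(p)-t_1(q)\ge0$ and $h_1(q)-h_1(p)\ge0$. Labels: a red edge $(x,F_1x)$ gets label $h_2(F_1x)-h_2(x)\in\{0,1\}$;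 a green edge $(p,F_2p)$ gets label $\frac12(h_1(F_2p)-h_1(p))\in\{0,\frac12,1\}$. Write $v\xrightarrow{i,a}w$ to say that there is an edge of color $i$ from $v$ to $w$ and it has label $a$. (K3) Along each string, labels on consecutive edges do not decrease (in the direction of the string). (K4) If $u\xrightarrow{1,a}v\xrightarrow{2,b}w$, then $a\ne b$; and if $a<b$ then $a=0$, $b=1$, and $u\xrightarrow{2,1}F_2u\xrightarrow{1,0}w$ (so $F_2F_1u=F_1F_2u=w$). If $p\xrightarrow{2,b}q\xrightarrow{1,a}s$, then $a\neq b$; and if $a>b$ then $a=1$, $b=0$, and $p\xrightarrow{1,1}F_1p\xrightarrow{2,0}s$ (so $F_1F_2p=F_2F_1p=s$). (K5) The following four implications hold for every vertex $x$, together with the dual of each (obtained by reversing all edges, i.e. interchanging $F_i$ and $E_i$ and replacing $v\xrightarrow{i,a}w$ by $w\xrightarrow{i,1-a}v$): (K5a) If $x\xrightarrow{2,1}F_2x$ and $x\xrightarrow{1,1}F_1x\xrightarrow{2,0}F_2F_1x$, then $F_1F_2^2F_1x$ and $F_2F_1^2F_2x$ are defined and equal, and $F_2F_1x\xrightarrow{2,1}F_2^2F_1x\xrightarrow{1,0}F_1F_2^2F_1x$ and $F_2x\xrightarrow{1,0}F_1F_2x\xrightarrow{1,1}F_1^2F_2x\xrightarrow{2,0}F_2F_1^2F_2x$. (K5b) If $x\xrightarrow{2,1}F_2x\xrightarrow{1,0}u$ (so $u=F_1F_2x$) and a green edge labeled $\frac12$ enters $u$, then $z=E_1E_2x$ is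 defined and $z\xrightarrow{1,1}E_2x\xrightarrow{2,0}x$, and $z\xrightarrow{2,1/2}F_2z\xrightarrow{1,0}F_1F_2z\xrightarrow{1,1}F_1^2F_2z\xrightarrow{2,1/2}u$. (K5c) If $x\xrightarrow{2,1}F_2x\xrightarrow{1,0}F_1F_2x\xrightarrow{1,0}F_1^2F_2x$ and $x\xrightarrow{1,1}F_1x\xrightarrow{2,1/2}F_2F_1x$, then $s=E_2F_1F_2x$ is defined, $s\xrightarrow{2,1/2}F_1F_2x$, $E_1s$ is defined, $E_1s\xrightarrow{1,1}s\xrightarrow{1,1}F_1s\xrightarrow{2,0}F_2F_1s$, $F_2F_1x\xrightarrow{1,0}F_1F_2F_1x$, and $F_1F_2F_1x=F_2F_1s$. (K5d) If $x\xrightarrow{2,1}F_2x\xrightarrow{1,0}F_1F_2x\xrightarrow{1,1}F_1^2F_2x$ and $x\xrightarrow{1,1}F_1x\xrightarrow{2,1/2}F_2F_1x$, then $F_1F_2F_1F_2F_1^2F_2x$ and $F_2F_1^2F_2F_1F_2F_1x$ are defined and equal to one vertex $c$, and the path $F_1^2F_2x\to c$ applying successively $F_2,F_1,F_2,F_1$ has labels $0,1,\frac12,0$, while the path $F_2F_1x\to c$ applying successively $F_1,F_2,F_1,F_1,F_2$ has labels $0,1,0,1,0$. *View from the sky.* By (K3) each red string has a unique critical vertex $*$: all edges of the string before it have label $0$ and all edges after it have label $1$. The view from the sky on $G$ is the labeled digraph $\hat G$ whose vertices $\hat v$ are the red strings of $G$, with vertex label $(X(\hat v),Y(\hat v))=(t_1(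 * ),h_1( * ))$, $*$ being the critical vertex of the red string $\hat v$; and there is an edge from $\hat v$ to $\hat v'$ with label $1$, $\frac12$ or $0$ whenever there is a green edge of $G$ with label $1$, $\frac12$ or $0$, respectively, going from a vertex of the red string $\hat v$ to a vertex of the red string $\hat v'$. *The graph $\hat K(H,0)$* ($H\in\mathbb Z_{\ge0}$): vertices $(k,l)$ with $0\le k\le\lfloor H/2\rfloor$, $0\le l\le H-2k$; the vertex $(k,l)$ has label $(X,Y)=(l,H-2k-l)$. Edges, whenever both ends exist: $(k,l)\to(k,l+1)$ with label $\frac12$; $(k,l)\to(k+1,l)$ with label $0$; $(k+1,l)\to(k,l+2)$ with label $1$. Its distinguished set (diagonal) is $\{(0,l):0\le l\le H\}$. *The graph $\hat K(0,A)$* ($A\in\mathbb Z_{\ge0}$): vertices $(k,j)$ with $0\le k\le A$, $0\le j\le A-k$; the vertex $(k,j)$ has label $(X,Y)=(k,k)$. Edges, whenever both ends exist: $(k,j)\to(k+1,j)$ with label $1$; $(k,j)\to(k-1,j+1)$ with label $0$. Its distinguished set (diagonal) is $\{(0,j):0\le j\le A\}$. *The graph $\hat K(H,A)$.* For digraphs $G_0,H_0$ with distinguished vertex subsets $S,T$, respectively, take disjoint copies $(G_0)_t$, $t\in T$, of $G_0$ and $(H_0)_s$, $s\in S$, of $H_0$, and for all $s\in S$, $t\in T$ identify the vertex $s$ of $(G_0)_t$ with the vertex $t$ of $(H_0)_s$. $\hat K(H,A)$ is the result of this operation for $G_0=\hat K(H,0)$, $H_0=\hat K(0,A)$ with $S,T$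 their diagonals. Edge labels are inherited. Vertex labels: a vertex in a copy of $\hat K(H,0)$ keeps its label $(X,Y)$ from $\hat K(H,0)$; a vertex with label $(X,Y)$ in the copy of $\hat K(0,A)$ attached at the distinguished vertex $(0,l)$ of $\hat K(H,0)$ gets the label $(X+l,\,Y+H-l)$ (the two rules agree on identified vertices). *$K(H,A)$* denotes the R-graph whose view from the sky is $\hat K(H,A)$ with these vertex labels (an R-graph is determined by its view from the sky). *)

(* Defs.v *)
From HB Require Import structures.
From Stdlib Require Import Relation_Operators.
From mathcomp Require Import all_boot all_order all_algebra.
From mathcomp Require Import boolp classical_sets.

Set Implicit Arguments.
Unset Strict Implicit.
Unset Printing Implicit Defensive.

Import Order.TTheory GRing.Theory Num.Theory.

Local Open Scope ring_scope.
Local Open Scope quotient_scope.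

Inductive color := red | green.

(* Color 1 is [red], color 2 is [green].  A two-coloured digraph on [V] is given
   by [e : color -> rel V], where [e i x y] says that an edge of colour i goes
   from x to y.  Parallel edges of the same colour, which a relation cannot
   represent, are excluded by axiom (K0). *)

Section Digraph.
Variables (V : choiceType) (e : color -> rel V).

Definition weakly_joined (i : color) : V -> V -> Prop :=
  clos_refl_sym_trans V (fun x y => e i x y).

Definition weakly_connected : Prop :=
  inhabited V /\
  forall x y, clos_refl_sym_trans V (fun u v => e red u v || e green u v) x y.

Definition source (s : V) : Prop := forall i v, ~~ e i v s.

(* [s] lists the vertices of a weakly connected component of (V, A_i), and this
   component is the simple directed path visiting [s] in this order. *)
Definition is_string (i : color) (s : seq V) : Prop :=
  [/\ s != [::], uniq s,
      forall v w, v \in s -> (w \in s <-> weakly_joined i v w)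
    & forall v w, v \in s -> w \in s -> e i v w = infix [:: v; w] s].

Definition K0 : Prop :=
  forall i v, exists2 s, is_string i s & v \in s.

(* The string P_i(v), unique under (K0). *)
Definition string (i : color) (v : V) : seq V :=
  xget [::] [set s | is_string i s /\ v \in s]%classic.

Definition t (i : color) (v : V) : nat := index v (string i v).
Definition h (i : color) (v : V) : nat := ((size (string i v)).-1 - t i v)%N.

Definition K1 : Prop :=
  (forall x y, e red x y ->
     (t green x)%:Z - (t green y)%:Z + (h green y)%:Z - (h green x)%:Z = 1) /\
  (forall p q, e green p q ->
     (t red p)%:Z - (t red q)%:Z + (h red q)%:Z - (h red p)%:Z = 2).

Definition K2 : Prop :=
  (forall x y, e red x y ->
     0 <= (t green x)%:Z - (t green y)%:Z /\
     0 <= (h green y)%:Z - (h green x)%:Z) /\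
  (forall p q, e green p q ->
     0 <= (t red p)%:Z - (t red q)%:Z /\
     0 <= (h red q)%:Z - (h red p)%:Z).

(* Meaningful only if [e i v w]. *)
Definition label (i : color) (v w : V) : rat :=
  match i with
  | red => (h green w)%:R - (h green v)%:R
  | green => ((h red w)%:R - (h red v)%:R) / 2
  end.

Definition arr (i : color) (a : rat) (v w : V) : Prop :=
  e i v w /\ label i v w = a.

Definition K3 : Prop :=
  forall i a b u v w, arr i a u v -> arr i b v w -> a <= b.

Definition K4 : Prop :=
  (forall a b u v w, arr red a u v -> arr green b v w ->
     a <> b /\
     (a < b -> [/\ a = 0, b = 1 &
                exists y, arr green 1 u y /\ arr red 0 y w])) /\
  (forall a b p q s, arr green b p q -> arr red a q s ->
     a <> b /\
     (b < a -> [/\ a = 1, b = 0 &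
                exists y, arr red 1 p y /\ arr green 0 y s])).

End Digraph.

(* The implications (K5a)-(K5d) are stated for an arbitrary labelled edge
   relation [r], in order to apply them also to the dual one.  As F_i and E_i
   are partial functions given by the edges, "F_i x is defined, equals y, and
   the edge has label a" is [r i a x y]. *)
Section K5.
Variables (V : Type) (r : color -> rat -> V -> V -> Prop).

Definition dual_arr (i : color) (a : rat) (v w : V) : Prop := r i (1 - a) w v.

(* y = F2 x, p = F1 x, q = F2 F1 x *)
Definition K5a : Prop := forall x y p q,
  r green 1 x y -> r red 1 x p -> r green 0 p q ->
  exists c m n k,
    [/\ r green 1 q m, r red 0 m c
      & [/\ r red 0 y n, r red 1 n k & r green 0 k c]].

(* y = F2 x, u = F1 F2 x, m = E2 x, z = E1 E2 x *)
Definition K5b : Prop := forall x y u v,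
  r green 1 x y -> r red 0 y u -> r green 2^-1 v u ->
  exists z m n k l,
    [/\ r red 1 z m, r green 0 m x
      & [/\ r green 2^-1 z n, r red 0 n k, r red 1 k l & r green 2^-1 l u]].

(* y = F2 x, w = F1 F2 x, w' = F1 F1 F2 x, p = F1 x, q = F2 F1 x;
   s = E2 F1 F2 x, s0 = E1 s, s1 = F1 s, c = F2 F1 s = F1 F2 F1 x *)
Definition K5c : Prop := forall x y w w' p q,
  r green 1 x y -> r red 0 y w -> r red 0 w w' ->
  r red 1 x p -> r green 2^-1 p q ->
  exists s s0 s1 c,
    [/\ r green 2^-1 s w, r red 1 s0 s, r red 1 s s1, r green 0 s1 c
      & r red 0 q c].

(* y = F2 x, w = F1 F2 x, w' = F1 F1 F2 x, p = F1 x, q = F2 F1 x *)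
Definition K5d : Prop := forall x y w w' p q,
  r green 1 x y -> r red 0 y w -> r red 1 w w' ->
  r red 1 x p -> r green 2^-1 p q ->
  exists c,
    (exists m1 m2 m3,
      [/\ r green 0 w' m1, r red 1 m1 m2, r green 2^-1 m2 m3 & r red 0 m3 c]) /\
    (exists n1 n2 n3 n4,
      [/\ r red 0 q n1, r green 1 n1 n2, r red 0 n2 n3, r red 1 n3 n4
        & r green 0 n4 c]).

Definition K5 : Prop := [/\ K5a, K5b, K5c & K5d].

End K5.

Record R_graph (V : choiceType) (e : color -> rel V) : Prop := RGraph {
  R_graph_K0 : K0 e;
  R_graph_K1 : K1 e;
  R_graph_K2 : K2 e;
  R_graph_K3 : K3 e;
  R_graph_K4 : K4 e;
  R_graph_K5 : K5 (arr e);
  R_graph_K5_dual : K5 (dual_arr (arr e))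
}.

Record lgraph := LGraph {
  vtx :> choiceType;
  arc : rat -> vtx -> vtx -> Prop;
  vlabel : vtx -> nat * nat
}.

Definition lgraph_iso (G G' : lgraph) : Prop :=
  exists f : G -> G',
    [/\ bijective f,
        forall a u v, arc a u v <-> arc a (f u) (f v)
      & forall v, vlabel (f v) = vlabel v].

Section Sky.
Variables (V : choiceType) (e : color -> rel V).

Definition red_string := {s : seq V | `[< is_string e red s >]}.

(* An edge (x, y) of the string [s] lies before [c] iff y is not after c. *)
Definition critical (s : seq V) (c : V) : Prop :=
  c \in s /\
  forall x y, infix [:: x; y] s ->
    ((index y s <= index c s)%N -> label e red x y = 0) /\
    ((index c s <= index x s)%N -> label e red x y = 1).

(* (X, Y) = (t_1(c), h_1(c)) for the critical vertex c; the default value is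
   irrelevant, since the critical vertex exists in an R-graph. *)
Definition sky_vlabel (s : red_string) : nat * nat :=
  xget (0, 0)%N
    [set xy | exists2 c, critical (val s) c &
                         xy = (t e red c, h e red c)]%classic.

Definition sky_arc (a : rat) (s s' : red_string) : Prop :=
  exists x y, [/\ x \in val s, y \in val s' & arr e green a x y].

Definition sky : lgraph := LGraph sky_arc sky_vlabel.

End Sky.

Section Khat0.
Variables H A : nat.

Definition KH0_vertex :=
  {p : nat * nat | (p.1 <= H./2)%N && (p.2 <= H - p.1.*2)%N}.

Definition KH0_arc (a : rat) (u v : KH0_vertex) : Prop :=
  let: (k, l) := val u in let: (k', l') := val v in
  [\/ [/\ a = 2^-1, k' = k & l' = l.+1],
      [/\ a = 0, k' = k.+1 & l' = l]
    | [/\ a = 1, k = k'.+1 & l' = l.+2]].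

Definition KH0_vlabel (u : KH0_vertex) : nat * nat :=
  let: (k, l) := val u in (l, H - k.*2 - l)%N.

Definition Khat_H0 : lgraph := LGraph KH0_arc KH0_vlabel.

Definition KH0_diag : pred Khat_H0 := fun u => (val u).1 == 0%N.

Definition K0A_vertex :=
  {p : nat * nat | (p.1 <= A)%N && (p.2 <= A - p.1)%N}.

Definition K0A_arc (a : rat) (u v : K0A_vertex) : Prop :=
  let: (k, j) := val u in let: (k', j') := val v in
  [/\ a = 1, k' = k.+1 & j' = j] \/ [/\ a = 0, k = k'.+1 & j' = j.+1].

Definition K0A_vlabel (u : K0A_vertex) : nat * nat :=
  let: (k, _) := val u in (k, k).

Definition Khat_0A : lgraph := LGraph K0A_arc K0A_vlabel.

Definition K0A_diag : pred Khat_0A := fun u => (val u).1 == 0%N.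

End Khat0.

Section Glue.
Variables (G0 H0 : lgraph) (S : pred G0) (T : pred H0).

(* [inl (g, t)] is the vertex g of the copy (G0)_t, and [inr (h, s)] is the
   vertex h of the copy (H0)_s. *)
Definition copies : choiceType :=
  ((G0 * {x : H0 | T x}) + (H0 * {x : G0 | S x}))%type.

Definition glue_rel (x y : copies) : bool :=
  match x, y with
  | inl p, inl q => p == q
  | inr p, inr q => p == q
  | inl (g, t), inr (h, s) | inr (h, s), inl (g, t) =>
      (g == val s) && (h == val t)
  end.

Lemma glue_rel_refl : reflexive glue_rel.
Proof. by case=> [[g u]|[w s]] /=; exact: eqxx. Qed.

Lemma glue_rel_sym : symmetric glue_rel.
Proof. by case=> [[g u]|[w s]] [[g' u']|[w' s']] //=; exact: eq_sym. Qed.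

Lemma glue_rel_trans : transitive glue_rel.
Proof.
case=> [[g u]|[w s]] [[g1 u1]|[w1 s1]] [[g2 u2]|[w2 s2]] //=.
- by move=> /eqP-> /eqP->.
- by move=> /eqP[-> ->].
- by move=> ? /eqP[<- <-].
- by move=> /andP[/eqP-> /eqP->] /andP[/eqP/val_inj-> /eqP->].
- by move=> /andP[/eqP-> /eqP->] /andP[/eqP-> /eqP/val_inj->].
- by move=> ? /eqP[<- <-].
- by move=> /eqP[-> ->].
- by move=> /eqP-> /eqP->.
Qed.

Canonical glue_equiv := EquivRel glue_rel glue_rel_refl glue_rel_sym
  glue_rel_trans.

Definition glued : choiceType := {eq_quot glue_equiv}.

Definition copies_arc (a : rat) (x y : copies) : Prop :=
  match x, y with
  | inl (g, t), inl (g', t') => t = t' /\ arc a g g'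
  | inr (h, s), inr (h', s') => s = s' /\ arc a h h'
  | _, _ => False
  end.

Definition glued_arc (a : rat) (x y : glued) : Prop :=
  exists x0 y0 : copies,
    [/\ x = \pi_{eq_quot glue_equiv} x0, y = \pi_{eq_quot glue_equiv} y0
      & copies_arc a x0 y0].

End Glue.

Section Khat.
Variables H A : nat.

Local Notation S := (@KH0_diag H).
Local Notation T := (@K0A_diag A).

Definition Khat_copies_vlabel (x : copies S T) : nat * nat :=
  match x with
  | inl (g, _) => vlabel g
  | inr (h, s) =>
      let: (X, Y) := vlabel h in let l := (val (val s)).2 in
      (X + l, Y + (H - l))%N
  end.

(* Reading the label on the representative is harmless, see
   [Khat_vlabel_pi]. *)
Definition Khat_vlabel (x : glued S T) : nat * nat :=
  Khat_copies_vlabel (repr x).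

Lemma Khat_vlabel_pi (x : copies S T) :
  Khat_vlabel (\pi_{eq_quot (glue_equiv S T)} x) = Khat_copies_vlabel x.
Proof.
have /eqmodP : repr (\pi_{eq_quot (glue_equiv S T)} x)
    = x %[mod {eq_quot (glue_equiv S T)}] by rewrite reprK.
rewrite /Khat_vlabel; move: (repr _) => y.
have agree (g : Khat_H0 H) (h : Khat_0A A) (t : {x | T x}) (s : {x | S x}) :
    g = val s -> h = val t ->
    Khat_copies_vlabel (inl (g, t)) = Khat_copies_vlabel (inr (h, s)).
  move=> -> ->; case: s t => [[[k l] /= kP] /= /eqP/= k0].
  case=> [[[k' j] /= k'P] /= /eqP/= k'0].
  by rewrite /KH0_vlabel /K0A_vlabel /= k0 k'0 subn0.
case: y x => [[g t]|[h s]] [[g' t']|[h' s']] /=.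
- by move=> /eqP[-> _].
- by move=> /andP[/eqP gE /eqP hE]; exact: (agree _ _ t).
- by move=> /andP[/eqP gE /eqP hE]; symmetry; exact: (agree _ _ t').
- by move=> /eqP[-> ->].
Qed.

Definition Khat : lgraph := LGraph (@glued_arc _ _ S T) Khat_vlabel.

End Khat.

(* Main.v *)
(* Each red string is represented by its critical vertex, and its position is
   measured by the four numbers (t_1, h_1, t_2, h_2) of that vertex.  By (K4) and
   (K5), an arc of the view from the sky always joins two critical vertices by
   one of five short paths: a single kind for the label 1/2, and for the labels 1
   and 0 one kind as in K(0,A) and one as in K(H,0).  Each kind changes the four
   numbers by a fixed vector.  (K5) also yields commuting squares, from which
   every string descends to a unique string with t_1 = t_2 = 0, and the end of
   this descent does not change along arcs; by connectedness it is the string of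
   the source.  The descent is determined by the four numbers, so they separate
   the strings, their range is computed along the way, and the same numbers are
   separating invariants of K(H,A). *)
Require Import Defs.
From Stdlib Require Import Relation_Operators.
From mathcomp Require Import all_boot all_order all_algebra.
From mathcomp Require Import boolp classical_sets.
From mathcomp Require Import zify.

Set Implicit Arguments.
Unset Strict Implicit.
Unset Printing Implicit Defensive.

(** The obstacle is that (K5) speaks of paths between arbitrary vertices, while the arcs of the sky
    join critical ones; so the ends of the paths that (K5) supplies have to be proved critical. The
    label (t_1, h_1) alone cannot separate strings: it is the same at corresponding places of all
    copies of K(H,0), which only (t_2, h_2) tells apart. Every arc must preserve the end of the
    descent, but only some arcs are steps of it. An arc labelled 1/2 off the diagonal, or a [zeroA]
    arc far from the first vertex of the diagonal, is carried across commuting squares, by induction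
    on t_2 and t_1 respectively, until it is replaced by steps. The copies and their gluing are
    never assembled inside G: the isomorphism only matches equal quadruples. *)

Section K5Kinds.
Variables (V : Type) (r0 r1 g0 gh g1 : V -> V -> Prop).

(* (K5a)-(K5d) with one relation per colour and label, so that the dual axioms
   are obtained by a permutation of the arguments. *)
Definition K5_kinds : Prop :=
  [/\ forall x y p q, g1 x y -> r1 x p -> g0 p q ->
        exists c m n k, [/\ g1 q m, r0 m c & [/\ r0 y n, r1 n k & g0 k c]],
      forall x y u v, g1 x y -> r0 y u -> gh v u ->
        exists z m n k l, [/\ r1 z m, g0 m x
          & [/\ gh z n, r0 n k, r1 k l & gh l u]],
      forall x y w w' p q, g1 x y -> r0 y w -> r0 w w' -> r1 x p -> gh p q ->
        exists s s' s1 c,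
          [/\ gh s w, r1 s' s, r1 s s1, g0 s1 c & r0 q c]
    & forall x y w w' p q, g1 x y -> r0 y w -> r1 w w' -> r1 x p -> gh p q ->
        exists c,
          (exists m1 m2 m3, [/\ g0 w' m1, r1 m1 m2, gh m2 m3 & r0 m3 c]) /\
          (exists n1 n2 n3 n4,
             [/\ r0 q n1, g1 n1 n2, r0 n2 n3, r1 n3 n4 & g0 n4 c])].

End K5Kinds.

(* [r0], [r1] are the red edges labelled 0, 1; [g0], [gh], [g1] the green edges
   labelled 0, 1/2, 1; [ss] is the relation of lying on the same red string.
   The fields are invariant under reversal of all edges, so that each lemma has
   a dual. *)
Record crystal (V : Type) := Crystal {
  r0 : V -> V -> Prop;
  r1 : V -> V -> Prop;
  g0 : V -> V -> Prop;
  gh : V -> V -> Prop;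
  g1 : V -> V -> Prop;
  ss : V -> V -> Prop;
  t1 : V -> nat;
  h1 : V -> nat;
  t2 : V -> nat;
  h2 : V -> nat;
  r0_stat : forall v w, r0 v w ->
    [/\ t1 w = (t1 v).+1, h1 v = (h1 w).+1, t2 v = (t2 w).+1 & h2 v = h2 w];
  r1_stat : forall v w, r1 v w ->
    [/\ t1 w = (t1 v).+1, h1 v = (h1 w).+1, t2 v = t2 w & h2 w = (h2 v).+1];
  g0_stat : forall v w, g0 v w ->
    [/\ t2 w = (t2 v).+1, h2 v = (h2 w).+1, t1 v = (t1 w).+2 & h1 v = h1 w];
  gh_stat : forall v w, gh v w ->
    [/\ t2 w = (t2 v).+1, h2 v = (h2 w).+1, t1 v = (t1 w).+1 & h1 w = (h1 v).+1];
  g1_stat : forall v w, g1 v w ->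
    [/\ t2 w = (t2 v).+1, h2 v = (h2 w).+1, t1 v = t1 w & h1 w = (h1 v).+2];
  red_out : forall v, 0 < h1 v -> exists w, r0 v w \/ r1 v w;
  red_in : forall v, 0 < t1 v -> exists u, r0 u v \/ r1 u v;
  green_out : forall v, 0 < h2 v -> exists w, [\/ g0 v w, gh v w | g1 v w];
  green_in : forall v, 0 < t2 v -> exists u, [\/ g0 u v, gh u v | g1 u v];
  red_fun : forall v w w', r0 v w \/ r1 v w -> r0 v w' \/ r1 v w' -> w = w';
  red_inj : forall u u' v, r0 u v \/ r1 u v -> r0 u' v \/ r1 u' v -> u = u';
  green_fun : forall v w w', [\/ g0 v w, gh v w | g1 v w] ->
    [\/ g0 v w', gh v w' | g1 v w'] -> w = w';
  green_inj : forall u u' v, [\/ g0 u v, gh u v | g1 u v] ->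
    [\/ g0 u' v, gh u' v | g1 u' v] -> u = u';
  ss_refl : forall v, ss v v;
  ss_sym : forall v w, ss v w -> ss w v;
  ss_trans : forall u v w, ss u v -> ss v w -> ss u w;
  ss_r0 : forall v w, r0 v w -> ss v w;
  ss_r1 : forall v w, r1 v w -> ss v w;
  ss_t1_inj : forall v w, ss v w -> t1 v = t1 w -> v = w;
  ss_len : forall v w, ss v w -> t1 v + h1 v = t1 w + h1 w;
  r1_r0 : forall u v w, r1 u v -> r0 v w -> False;
  r0_green : forall u v w, r0 u v -> [\/ g0 v w, gh v w | g1 v w] ->
    g1 v w /\ exists2 y, g1 u y & r0 y w;
  green_r1 : forall p q s, [\/ g0 p q, gh p q | g1 p q] -> r1 q s ->
    g0 p q /\ exists2 y, r1 p y & g0 y s;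
  r1_g1 : forall u v w, r1 u v -> g1 v w -> False;
  g0_r0 : forall u v w, g0 u v -> r0 v w -> False;
  axK5 : K5_kinds r0 r1 g0 gh g1;
  axK5_dual : K5_kinds (fun v w => r1 w v) (fun v w => r0 w v)
    (fun v w => g1 w v) (fun v w => gh w v) (fun v w => g0 w v)
}.

(** * Edge reversal, critical vertices and the five kinds of arcs *)

Section Crystal.
Variables (V : Type) (C : crystal V).

Local Notation r0 := (r0 C).
Local Notation r1 := (r1 C).
Local Notation g0 := (g0 C).
Local Notation gh := (gh C).
Local Notation g1 := (g1 C).
Local Notation ss := (ss C).
Local Notation t1 := (t1 C).
Local Notation h1 := (h1 C).
Local Notation t2 := (t2 C).
Local Notation h2 := (h2 C).

Lemma or3_rev (P Q R : Prop) : [\/ P, Q | R] <-> [\/ R, Q | P].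
Proof. by split; case; [constructor 3|constructor 2|constructor 1|
  constructor 3|constructor 2|constructor 1]. Qed.

(** Kept transparent, since facts about [dual C] are read back as facts about [C] by conversion. *)
Definition dual : crystal V.
Proof.
apply: (@Crystal V (fun v w => r1 w v) (fun v w => r0 w v)
  (fun v w => g1 w v) (fun v w => gh w v) (fun v w => g0 w v)
  ss h1 t1 h2 t2) => /=.
- by move=> v w e; case: (r1_stat e).
- by move=> v w e; case: (r0_stat e).
- by move=> v w e; case: (g1_stat e).
- by move=> v w e; case: (gh_stat e).
- by move=> v w e; case: (g0_stat e).
- by move=> v e; have [u /or_comm] := red_in e; exists u.
- by move=> v e; have [u /or_comm] := red_out e; exists u.
- by move=> v e; have [u /or3_rev] := green_in e; exists u.
- by move=> v e; have [u /or3_rev] := green_out e; exists u.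
- by move=> v w w' /or_comm + /or_comm; apply: red_inj.
- by move=> v w w' /or_comm + /or_comm; apply: red_fun.
- by move=> v w w' /or3_rev + /or3_rev; apply: green_inj.
- by move=> v w w' /or3_rev + /or3_rev; apply: green_fun.
- exact: ss_refl.
- exact: ss_sym.
- exact: ss_trans.
- by move=> v w e; apply/ss_sym/ss_r1.
- by move=> v w e; apply/ss_sym/ss_r0.
- by move=> v w vw eq_h1; apply: (ss_t1_inj vw); have := ss_len vw; lia.
- by move=> v w vw; rewrite ![h1 _ + _]addnC (ss_len vw).
- by move=> u v w vu wv; exact: r1_r0 wv vu.
- move=> u v w vu /or3_rev wv.
  by have [? [y ? ?]] := green_r1 wv vu; split=> //; exists y.
- move=> u v w /or3_rev vu wv.
  by have [? [y ? ?]] := r0_green wv vu; split=> //; exists y.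
- by move=> u v w vu wv; exact: g0_r0 wv vu.
- by move=> u v w vu wv; exact: r1_g1 wv vu.
- exact: axK5_dual.
- exact: axK5.
Defined.

(** Testing the two adjacent red edges is enough, because labels do not decrease along a string. *)
Definition crit c := (forall u, ~ r1 u c) /\ (forall w, ~ r0 c w).

(* The five kinds of arcs between critical vertices.  [oneA] and [zeroA] behave
   as the arcs of K(0,A), [oneH] and [zeroH] as those of K(H,0). *)
Definition half_arc c c' := [/\ crit c, crit c'
  & exists p q, [/\ r1 c p, gh p q & r0 q c']].
Definition oneA c c' := [/\ crit c, crit c' & exists2 y, g1 c y & r0 y c'].
Definition oneH c c' := [/\ crit c, crit c'
  & exists y w, [/\ g1 c y, r0 y w & r0 w c']].
Definition zeroA c c' := [/\ crit c, crit c' & exists2 p, r1 c p & g0 p c'].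
Definition zeroH c c' := [/\ crit c, crit c'
  & exists p q, [/\ r1 c p, r1 p q & g0 q c']].

End Crystal.

Ltac as_red A := first [exact (or_introl A) | exact (or_intror A)].
Ltac as_green A :=
  first [exact (Or31 _ _ A) | exact (Or32 _ _ A) | exact (Or33 _ _ A)].

Ltac merge x y E := first [subst y | subst x].

(** Merges vertices that the functionality of [F_i] and [E_i] forces to be equal, so that facts from
    different paths meet at one vertex. *)
Ltac det := repeat match goal with
  | A : _ ?v ?w, B : _ ?v ?w' |- _ =>
      tryif constr_eq w w' then fail else
      let E := fresh in
      first [ have E : w = w' by apply: (@red_fun _ _ v); [as_red A | as_red B]
            | have E : w = w'
                by apply: (@green_fun _ _ v); [as_green A | as_green B] ];
      merge w w' E
  | A : _ ?v ?w, B : _ ?v' ?w |- _ =>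
      tryif constr_eq v v' then fail else
      let E := fresh in
      first [ have E : v = v'
                by apply: (@red_inj _ _ _ _ w); [as_red A | as_red B]
            | have E : v = v'
                by apply: (@green_inj _ _ _ _ w); [as_green A | as_green B] ];
      merge v v' E
  end.

Ltac stat_lia := repeat match goal with
  | A : r0 _ _ _ |- _ => case: (r0_stat A) => ? ? ? ?; clear A
  | A : r1 _ _ _ |- _ => case: (r1_stat A) => ? ? ? ?; clear A
  | A : g0 _ _ _ |- _ => case: (g0_stat A) => ? ? ? ?; clear A
  | A : gh _ _ _ |- _ => case: (gh_stat A) => ? ? ? ?; clear A
  | A : g1 _ _ _ |- _ => case: (g1_stat A) => ? ? ? ?; clear A
  end; lia.

(** After merging, the contradiction is a forbidden pair of consecutive edges, or numerical:
    different labels on one edge shift the four numbers differently. *)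
Ltac clash := exfalso; det; (match goal with
  | A : crit _ ?c, B : r1 _ _ ?c |- _ => by case: A => /(_ _ B)
  | A : crit _ ?c, B : r0 _ ?c _ |- _ => by case: A => _ /(_ _ B)
  | A : r1 _ _ ?c, B : r0 _ ?c _ |- _ => by exact: (r1_r0 A B)
  | A : r1 _ _ ?c, B : g1 _ ?c _ |- _ => by exact: (r1_g1 A B)
  | A : g0 _ _ ?c, B : r0 _ ?c _ |- _ => by exact: (g0_r0 A B)
  | _ => stat_lia
  end).

Lemma crit_dual V (C : crystal V) c : crit (dual C) c <-> crit C c.
Proof. by split=> -[? ?]; split. Qed.

Lemma half_dual V (C : crystal V) c c' :
  half_arc (dual C) c c' <-> half_arc C c' c.
Proof.
by split=> -[/crit_dual ? /crit_dual ? [p [q [? ? ?]]]]; split=> //; exists q, p.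
Qed.

Lemma oneA_dual V (C : crystal V) c c' : oneA (dual C) c c' <-> zeroA C c' c.
Proof. by split=> -[/crit_dual ? /crit_dual ? [p ? ?]]; split=> //; exists p. Qed.

Lemma zeroA_dual V (C : crystal V) c c' : zeroA (dual C) c c' <-> oneA C c' c.
Proof. by split=> -[/crit_dual ? /crit_dual ? [p ? ?]]; split=> //; exists p. Qed.

Lemma oneH_dual V (C : crystal V) c c' : oneH (dual C) c c' <-> zeroH C c' c.
Proof.
by split=> -[/crit_dual ? /crit_dual ? [p [q [? ? ?]]]]; split=> //; exists q, p.
Qed.

Lemma zeroH_dual V (C : crystal V) c c' : zeroH (dual C) c c' <-> oneH C c' c.
Proof.
by split=> -[/crit_dual ? /crit_dual ? [p [q [? ? ?]]]]; split=> //; exists q, p.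
Qed.

(** * Edges and arcs at a critical vertex *)

Lemma crit_r0r1 V (C : crystal V) u c w : r0 C u c -> r1 C c w -> crit C c.
Proof. by move=> uc cw; split=> [x xc|x cx]; clash. Qed.

(** If a red edge enters [c], it has label 0 and (K4) forces label 1 on the green edge; if none
    enters, t_1 = 0 excludes the labels 0 and 1/2, which lower t_1. *)
Lemma crit_out V (C : crystal V) c w :
  crit C c -> [\/ g0 C c w, gh C c w | g1 C c w] -> g1 C c w.
Proof.
move=> cc cw; case: (posnP (t1 C c)) => [c0|e].
  by case: cw => // cw; clash.
have [u [uc|/(proj1 cc)//]] := red_in e.
by have [] := r0_green uc cw.
Qed.

Lemma out_g1_r0 V (C : crystal V) p q : g1 C p q -> exists s, r0 C q s.
Proof.
move=> pq; have [|s [qs|qs]] := @red_out _ C q; first by stat_lia.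
  by exists s.
have [? _] := green_r1 (Or33 _ _ pq) qs; clash.
Qed.

Lemma out_gh_r0 V (C : crystal V) p q : gh C p q -> exists s, r0 C q s.
Proof.
move=> pq; have [|s [qs|qs]] := @red_out _ C q; first by stat_lia.
  by exists s.
have [? _] := green_r1 (Or32 _ _ pq) qs; clash.
Qed.

Lemma one_half_before_crit V (C : crystal V) x p q :
  crit C x -> r1 C x p -> gh C p q -> 0 < h2 C x ->
  exists2 c, r0 C q c & crit C c.
Proof.
have [_ _ K5c K5d] := axK5 C.
move=> cx xp pq e; have [y /(crit_out cx) xy] := green_out e.
have [w yw] := out_g1_r0 xy.
have [|w' [ww'|ww']] := @red_out _ C w; first by stat_lia.
- have [s [s0 [s1 [c [sw s0s ss1 s1c qc]]]]] := K5c _ _ _ _ _ _ xy yw ww' xp pq.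
  by exists c => //; split=> [u uc|z cz]; clash.
- have [c [_ [n1 [n2 [n3 [n4 [qn1 n1n2 n2n3 n3n4 n4c]]]]]]] :=
    K5d _ _ _ _ _ _ xy yw ww' xp pq.
  (* If the red edge to [z] had label 0, (K4) would put a green edge labelled 1 from [z] to [n3],
     where it is followed by a red edge labelled 1. *)
  exists n1 => //; split=> [u un1|z n1z]; first by clash.
  have [|z' zz'] := @green_out _ C z; first by stat_lia.
  have [zz'1 [y' n1y' y'z']] := r0_green n1z zz'.
  det.
  have [? _] := green_r1 (Or33 _ _ zz'1) n3n4; clash.
Qed.

(* A green edge labelled 1/2 starts just after a critical vertex.  Otherwise go
   back along the red string of its head: the green edge entering the previous
   vertex has label 1/2 or 1; the former is excluded by induction and (K5c),
   (K5d), the latter by (K5b). *)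
Lemma half_after_crit V (C : crystal V) p q :
  gh C p q -> exists2 c, r1 C c p & crit C c.
Proof.
have [_ K5b _ _] := axK5 C.
move: {-1}(t1 C q).+1 (leqnn (t1 C q).+1) => n.
elim: n p q => // n IH p q ltq pq.
have [|p' [p'p|p'p]] := @red_in _ C p; first by stat_lia.
  by have [? _] := r0_green p'p (Or32 _ _ pq); clash.
exists p' => //; split=> [p'' p''p'|w p'w]; last by clash.
have [q' qq'] := out_gh_r0 pq.
have [|q0 [q0q|q0q]] := @red_in _ C q; [by stat_lia| |by clash].
have [|x [xq0|xq0|xq0]] := @green_in _ C q0; first by stat_lia.
- by clash.
- have [|x' x'x cx'] := IH x q0 _ xq0; first by stat_lia.
  have [|c q0c cc] := one_half_before_crit cx' x'x xq0; first by stat_lia.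
  by clash.
- have [z [m [n' [k [l [zm mx [zn' n'k kl lq]]]]]]] := K5b _ _ _ _ xq0 q0q pq.
  by clash.
Qed.

Lemma half_before_crit V (C : crystal V) p q :
  gh C p q -> exists2 c, r0 C q c & crit C c.
Proof.
move=> pq; have [c ? /crit_dual ?] := @half_after_crit _ (dual C) _ _ pq.
by exists c.
Qed.

Lemma crit_in V (C : crystal V) u c :
  crit C c -> [\/ g0 C u c, gh C u c | g1 C u c] -> g0 C u c.
Proof. by move=> /crit_dual cc /or3_rev; apply: (crit_out cc). Qed.

(** By (K4), a green edge labelled 1 is carried along red edges labelled 0. *)
Lemma g1_r0 V (C : crystal V) v w v' :
  g1 C v w -> r0 C v v' -> exists2 w', g1 C v' w' & r0 C w w'.
Proof.
move=> vw vv'; have [|w' v'w'] := @green_out _ C v'; first by stat_lia.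
have [v'w'1 [y vy yw']] := r0_green vv' v'w'.
by exists w' => //; det.
Qed.

Lemma g1_r0_before V (C : crystal V) v w w0 :
  g1 C v w -> r0 C w0 w -> exists2 v0, g1 C v0 w0 & r0 C v0 v.
Proof.
move=> vw w0w; have [|v0 [v0v|v0v]] := @red_in _ C v; [by stat_lia| |by clash].
have [_ [y ? ?]] := r0_green v0v (Or33 _ _ vw).
by exists v0 => //; det.
Qed.

Ltac open_arcs := repeat match goal with
  | A : half_arc _ _ _ |- _ => case: A => ? ? [? [? [? ? ?]]]
  | A : oneA _ _ _ |- _ => case: A => ? ? [? ? ?]
  | A : oneH _ _ _ |- _ => case: A => ? ? [? [? [? ? ?]]]
  | A : zeroA _ _ _ |- _ => case: A => ? ? [? ? ?]
  | A : zeroH _ _ _ |- _ => case: A => ? ? [? [? [? ? ?]]]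
  end.

Ltac arc_lia := open_arcs; stat_lia.
Ltac arc_clash := exfalso; open_arcs; clash.
Ltac arc_det := open_arcs; det; reflexivity.

Lemma oneA_or_oneH V (C : crystal V) c : crit C c -> 0 < h2 C c ->
  exists c', oneA C c c' \/ oneH C c c'.
Proof.
move=> cc e; have [y /(crit_out cc) cy] := green_out e.
have [w yw] := out_g1_r0 cy.
have [|w' [ww'|ww']] := @red_out _ C w; first by stat_lia.
- exists w'; right.
  (* Label 1/2 on the green edge into [w] makes [w'] critical; label 1 would yield, by a square, a
     red edge labelled 0 leaving [c]. *)
  have [|x [xw|xw|xw]] := @green_in _ C w; first by stat_lia.
  + by clash.
  + have [c' wc' cc'] := half_before_crit xw; det.
    by split=> //; exists y, w.
  + by have [x0 ? ?] := g1_r0_before xw yw; clash.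
- by exists w; left; split=> //; [exact: crit_r0r1 yw ww' | exists y].
Qed.

(** The triangle of K(H,0): a [oneH] arc undoes a [zeroH] arc and then follows two arcs labelled
    1/2. It is the content of (K5b). *)
Lemma oneH_half V (C : crystal V) c c' : oneH C c c' ->
  exists d e, [/\ zeroH C d c, half_arc C d e & half_arc C e c'].
Proof.
have [_ K5b _ _] := axK5 C.
move=> [cc cc' [y [w [cy yw wc']]]].
have [|x [xw|xw|xw]] := @green_in _ C w; first by stat_lia.
- by clash.
- have [z [m [n [k [l [zm mc [zn nk kl lw]]]]]]] := K5b _ _ _ _ cy yw xw.
  have [d dz cd] := half_after_crit zn; have ck := crit_r0r1 nk kl.
  exists d, k; split; split=> //.
  + by exists z, m.
  + by exists z, n.
  + by exists l, w.
- by have [x0 ? ?] := g1_r0_before xw yw; clash.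
Qed.

Lemma crit_one_tail V (C : crystal V) x q c :
  g1 C x q -> r0 C q c -> crit C c -> crit C x.
Proof.
move=> xq qc cc; split=> [u ux|x1 xx1]; first by clash.
have [w' x1w' qw'] := g1_r0 xq xx1; det.
by have ? := crit_in cc (Or33 _ _ x1w'); clash.
Qed.

Lemma crit_zero_head V (C : crystal V) p q c :
  g0 C q p -> r1 C c q -> crit C c -> crit C p.
Proof.
by move=> qp cq cc; apply/crit_dual/(@crit_one_tail _ (dual C) _ q c)/crit_dual.
Qed.

Lemma oneA_or_half V (C : crystal V) c : crit C c -> 0 < t1 C c ->
  exists s, oneA C s c \/ half_arc C s c.
Proof.
move=> cc e; have [q [qc|/(proj1 cc)//]] := red_in e.
have [|x [xq|xq|xq]] := @green_in _ C q; first by stat_lia.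
- by clash.
- have [s sx cs] := half_after_crit xq.
  by exists s; right; split=> //; exists x, q.
- exists x; left; split=> //; last by exists q.
  exact: crit_one_tail xq qc cc.
Qed.

Lemma half_oneH V (C : crystal V) s c :
  half_arc C s c -> 1 < t1 C c -> exists x, oneH C x c.
Proof.
move=> [cs cc [p [q [sp pq qc]]]] tc.
have [|q0 [q0q|q0q]] := @red_in _ C q; [by stat_lia| |by clash].
have [|x [xq0|xq0|xq0]] := @green_in _ C q0; first by stat_lia.
- by clash.
- by have [z q0z cz] := half_before_crit xq0; clash.
- exists x; split=> //; last by exists q0, q.
  split=> [u ux|x1 xx1]; first by clash.
  by have [w' ? ?] := g1_r0 xq0 xx1; clash.
Qed.

Lemma half_half_inj V (C : crystal V) s s' c :
  half_arc C s c -> half_arc C s' c -> s = s'.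
Proof.
by move=> [cs cc [p [q [sp pq qc]]]] [cs' _ [p' [q' [sp' pq' qc']]]]; det.
Qed.

(** If an arc labelled 1/2 left [p] instead, [half_oneH] and the triangle of [oneH_half] would make
    another one enter [p], along the green edge from [s] that already has label 1. *)
Lemma oneA_zeroA V (C : crystal V) s p : oneA C s p -> exists r, zeroA C p r.
Proof.
move=> [cs cp [y sy yp]].
have [|p1 [pp1|pp1]] := @red_out _ C p; [by stat_lia|by clash|].
have [|r [p1r|p1r|p1r]] := @green_out _ C p1; first by stat_lia.
- by exists r; split=> //; [exact: crit_zero_head p1r pp1 cp | exists p1].
- have [r2 rr2 cr2] := half_before_crit p1r.
  have pr2 : half_arc C p r2 by split=> //; exists p1, r.
  have [|x xr2] := half_oneH pr2; first by stat_lia.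
  have [d [e [_ de er2]]] := oneH_half xr2.
  have E := half_half_inj er2 pr2; subst e.
  by case: de => _ _ [p' [q' [? ? ?]]]; clash.
- by clash.
Qed.

Lemma zeroA_oneA V (C : crystal V) p r : zeroA C p r -> exists s, oneA C s p.
Proof.
by move=> /oneA_dual pr; have [s /zeroA_dual] := oneA_zeroA pr; exists s.
Qed.

Lemma zeroH_half V (C : crystal V) c' c : zeroH C c' c ->
  exists d e, [/\ oneH C c d, half_arc C e d & half_arc C c' e].
Proof.
move=> /oneH_dual cc'.
have [d [e [/zeroH_dual ? /half_dual ? /half_dual ?]]] := oneH_half cc'.
by exists d, e.
Qed.

Lemma half_or_zeroA V (C : crystal V) c : crit C c -> 0 < h1 C c ->
  exists s, zeroA C c s \/ half_arc C c s.
Proof.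
move=> cc e; have [|s sP] := @oneA_or_half _ (dual C) c _ e; first exact/crit_dual.
by exists s; case: sP => [/oneA_dual|/half_dual]; [left|right].
Qed.

Lemma half_zeroH V (C : crystal V) s c : half_arc C c s -> 1 < h1 C c ->
  exists x, zeroH C c x.
Proof.
by move=> /half_dual sc e; have [x /oneH_dual] := half_oneH sc e; exists x.
Qed.

Lemma zeroA_or_zeroH V (C : crystal V) c : crit C c -> 0 < t2 C c ->
  exists c', zeroA C c' c \/ zeroH C c' c.
Proof.
move=> cc e; have [|s sP] := @oneA_or_oneH _ (dual C) c _ e; first exact/crit_dual.
by exists s; case: sP => [/oneA_dual|/oneH_dual]; [left|right].
Qed.

(** * Commuting squares of arcs *)

Lemma zeroA_one_square V (C : crystal V) p r : zeroA C p r -> 0 < h2 C p ->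
  exists n c, [/\ oneA C p n, oneA C r c & zeroA C n c].
Proof.
have [K5a _ _ _] := axK5 C.
move=> [cp cr [q pq qr]] e; have [y /(crit_out cp) py] := green_out e.
have [c [m [n [k [rm mc [yn nk kc]]]]]] := K5a _ _ _ _ py pq qr.
have cn := crit_r0r1 yn nk.
have cc : crit C c by split=> [u uc|w cw]; clash.
exists n, c; split; split=> //; [by exists y | by exists m | by exists k].
Qed.

Lemma zeroA_oneA_square V (C : crystal V) p r n : zeroA C p r -> oneA C p n ->
  exists2 c, oneA C r c & zeroA C n c.
Proof.
move=> pr pn; have [|n' [c [pn' rc n'c]]] := zeroA_one_square pr; first by arc_lia.
by exists c => //; open_arcs; det; split=> //; eexists; eassumption.
Qed.

(** With the triangle at hand, (K5c) says that arcs labelled 1/2 commute with [zeroH] arcs. *)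
Lemma oneH_half_square V (C : crystal V) c c' r :
  oneH C c c' -> half_arc C c r ->
  exists d e, [/\ zeroH C d c, half_arc C d e & zeroH C e r].
Proof.
have [_ _ K5c _] := axK5 C.
move=> cc' cr; have [d [e [dc de ec']]] := oneH_half cc'; exists d, e; split=> //.
move: cc' cr ec' => [? ? [y [w [cy yw wc']]]] [_ ? [p [q [cp pq qr]]]].
move=> [? _ [k [l [ek kl lc']]]].
have [s [s0 [s1 [x [sw s0s ss1 s1x qx]]]]] := K5c _ _ _ _ _ _ cy yw wc' cp pq.
by split=> //; exists k, s1; det.
Qed.

Lemma zeroH_half_square V (C : crystal V) c c' r :
  zeroH C c' c -> half_arc C r c ->
  exists d e, [/\ oneH C c d, half_arc C e d & oneH C r e].
Proof.
move=> /oneH_dual c'c /half_dual rc.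
have [d [e [/zeroH_dual ? /half_dual ? /zeroH_dual ?]]] := oneH_half_square c'c rc.
by exists d, e.
Qed.

(** By (K5d), the passage [oneA] then [zeroA], which leads from one copy of K(H,0) to the next,
    commutes with arcs labelled 1/2. *)
Lemma oneA_half_square V (C : crystal V) p n r : oneA C p n -> half_arc C p r ->
  exists m k c, [/\ zeroA C n m, oneA C r k, zeroA C k c & half_arc C m c].
Proof.
have [_ _ _ K5d] := axK5 C.
move=> pn pr; have [m nm] := oneA_zeroA pn; move: (nm) pn pr.
move=> [cn cm [w' nw' w'm]] [cp _ [y py yn]] [_ cr [p1 [q [pp1 p1q qr]]]].
have [c [[m1 [m2 [m3 [w'm1 m1m2 m2m3 m3c]]]]]] := K5d _ _ _ _ _ _ py yn nw' pp1 p1q.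
move=> [n1 [n2 [n3 [n4 [qn1 n1n2 n2n3 n3n4 n4c]]]]].
have [c' m3c' cc'] := half_before_crit m2m3.
have cn3 := crit_r0r1 n2n3 n3n4.
exists m, n3, c; split=> //.
- by det; split=> //; exists n2.
- by det; split=> //; exists n4.
- by det; split=> //; exists m2, m3.
Qed.

(** * The critical vertex of a red string, and the arc induced by a green edge *)

(** Follow edges labelled 0 forwards until none leaves, then edges labelled 1 backwards. *)
Lemma crit_exists V (C : crystal V) v : exists2 c, crit C c & ss C v c.
Proof.
have backward n u : t1 C u < n -> (forall w, ~ r0 C u w) ->
    exists2 c, crit C c & ss C u c.
  elim: n u => // n IH u un noout.
  have [u0|e] := posnP (t1 C u).
    by exists u; [split=> // x xu; stat_lia | exact: ss_refl].
  have [x [xu|xu]] := red_in e.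
  - by exists u; [split=> // y yu; clash | exact: ss_refl].
  - have [||c cc xc] := IH x; first by stat_lia.
      by move=> w xw; clash.
    by exists c => //; apply: ss_trans xc; apply/ss_sym/ss_r1.
move: {-1}(h1 C v).+1 (leqnn (h1 C v).+1) => n.
elim: n v => // n IH v vn.
have [v0|e] := posnP (h1 C v).
  by apply: backward (leqnn _) _ => w vw; stat_lia.
have [w [vw|vw]] := red_out e.
- have [|c cc wc] := IH w; first by stat_lia.
  by exists c => //; apply: ss_trans wc; apply: ss_r0.
- by apply: backward (leqnn _) _ => x vx; clash.
Qed.

Lemma r1_after_crit V (C : crystal V) c v : crit C c -> ss C c v ->
  t1 C c < t1 C v -> exists u, r1 C u v.
Proof.
move: {-1}(t1 C v).+1 (leqnn (t1 C v).+1) => n.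
elim: n v => // n IH v vn cc cv cltv.
have [|u [uv|uv]] := @red_in _ C v; [by lia| |by exists u].
have cu : ss C c u by apply: ss_trans cv _; apply/ss_sym/ss_r0.
have [|eq_t] : t1 C c < t1 C u \/ t1 C c = t1 C u by stat_lia.
  by move=> e; have [|x xu] := IH u _ cc cu e; [stat_lia | clash].
by have E := ss_t1_inj cu eq_t; subst u; clash.
Qed.

Lemma crit_unique V (C : crystal V) c c' : crit C c -> crit C c' ->
  ss C c c' -> c = c'.
Proof.
wlog le_t : c c' / t1 C c <= t1 C c' => [IH|] cc cc' cs.
  have [/IH->//|lt_t] := leqP (t1 C c) (t1 C c').
  by apply/esym/IH => //; [exact: ltnW | exact: ss_sym].
have [lt_t|le_t'] := ltnP (t1 C c) (t1 C c').
  by have [u uc'] := r1_after_crit cc cs lt_t; clash.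
by apply: (ss_t1_inj cs); apply/eqP; rewrite eqn_leq le_t.
Qed.

Lemma crit_same V (C : crystal V) v c c' : ss C v c -> ss C v c' ->
  crit C c -> crit C c' -> c = c'.
Proof.
by move=> vc vc' cc cc'; exact: crit_unique cc cc' (ss_trans (ss_sym vc) vc').
Qed.

Lemma r1_crit_le V (C : crystal V) c v w : crit C c -> ss C c v -> r1 C v w ->
  t1 C c <= t1 C v.
Proof.
move=> cc cv vw; rewrite leqNgt; apply/negP => ltv.
have [u /= vu] : exists u, r1 (dual C) u v; last by clash.
apply: (@r1_after_crit _ (dual C) c v) => //=; first exact/crit_dual.
by have := ss_len cv; lia.
Qed.

(** No red edge labelled 1 enters [v], so [v] does not lie after [c]; the squares of [g1_r0] carry
    the green edge forwards to [c] without leaving the two strings. *)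
Lemma g1_arc V (C : crystal V) v w c : g1 C v w -> crit C c -> ss C v c ->
  exists2 c', ss C w c' & oneA C c c' \/ oneH C c c'.
Proof.
move: {-1}(h1 C v).+1 (leqnn (h1 C v).+1) => n.
elim: n v w => // n IH v w vn vw cc vc.
have [E|nvc] := pselect (v = c).
  subst c; have [|c' c'P] := oneA_or_oneH cc; first by stat_lia.
  exists c' => //; case: c'P => [[_ _ [y vy yc']]|[_ _ [y [z [vy yz zc']]]]].
    by det; exact: ss_r0.
  by det; apply: ss_trans (ss_r0 yz) (ss_r0 zc').
have [v' vv'] : exists v', r0 C v v'.
  apply: contrapT => nr0; apply: nvc; apply: crit_unique vc => //.
  split=> [u uv|v' vv']; first by clash.
  by apply: nr0; exists v'.
have [w' v'w' ww'] := g1_r0 vw vv'.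
have [||c' wc' c'P] := IH _ _ _ v'w' cc; first by stat_lia.
  exact: ss_trans (ss_sym (ss_r0 vv')) vc.
by exists c' => //; exact: ss_trans (ss_r0 ww') wc'.
Qed.

Lemma g0_arc V (C : crystal V) v w c : g0 C v w -> crit C c -> ss C w c ->
  exists2 c', ss C v c' & zeroA C c' c \/ zeroH C c' c.
Proof.
move=> vw /crit_dual cc wc.
have [c' vc' c'P] := @g1_arc _ (dual C) w v c vw cc wc.
by exists c' => //; case: c'P => [/oneA_dual|/oneH_dual]; [left|right].
Qed.

Lemma gh_arc V (C : crystal V) v w : gh C v w ->
  exists c c', [/\ ss C v c, ss C w c' & half_arc C c c'].
Proof.
move=> vw; have [c cv cc] := half_after_crit vw.
have [c' wc' cc'] := half_before_crit vw.
exists c, c'; split; [exact/ss_sym/ss_r1 | exact: ss_r0 |].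
by split=> //; exists v, w.
Qed.

(** * The canonical descent and the invariance of its end *)

Lemma zeroA_oneH V (C : crystal V) p r d : zeroA C p r -> oneH C p d -> False.
Proof.
by move=> pr pd; have [|n [c [pn _ _]]] := zeroA_one_square pr; [arc_lia | arc_clash].
Qed.

Lemma zeroH_oneA V (C : crystal V) q s p : zeroH C q p -> oneA C s p -> False.
Proof.
move=> qp sp; have [d [e [pd _ _]]] := zeroH_half qp.
by have [r pr] := oneA_zeroA sp; exact: zeroA_oneH pr pd.
Qed.

Section Parent.
Variables (V : Type) (C : crystal V).

(* The canonical descent: undo a [zeroH] arc, else a [oneA] arc, else an arc
   labelled 1/2, else move to the neighbouring copy of K(H,0). *)
Variant parent (Q P : V) : Prop :=
| Parent_zeroH of zeroH C Q P
| Parent_oneA of oneA C Q P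
| Parent_half of half_arc C Q P & (forall z, ~ zeroH C z P)
| Parent_diag E of oneA C Q E & zeroA C E P & t1 C P = 0.

Inductive rooted (D : V) : V -> Prop :=
| Rooted_root of crit C D & t1 C D = 0 & t2 C D = 0 : rooted D D
| Rooted_parent Q P of parent Q P & rooted D Q : rooted D P.

Lemma parent_fun Q Q' P : parent Q P -> parent Q' P -> Q = Q'.
Proof.
case=> [qp|qp|qp np|E qe ep p0].
- case=> [qp'|qp'|qp' np|E qe ep p0]; try by arc_det.
  + by case: (zeroH_oneA qp qp').
  + by case: (np Q).
  + by arc_clash.
- case=> [qp'|qp'|qp' np|E qe ep p0]; [|by arc_det|by arc_clash..].
  by case: (zeroH_oneA qp' qp).
- by case=> [/np//|qp'|qp' _|E qe ep p0]; [arc_clash|arc_det|arc_clash].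
- by case=> [qp'|qp'|qp' np|E' qe' ep' p0']; [arc_clash..|arc_det].
Qed.

Lemma parent_crit Q P : parent Q P -> crit C Q.
Proof. by case=> [[]|[]|[]|E []]. Qed.

Lemma rooted_crit D P : rooted D P -> crit C P.
Proof. by case=> // Q {}P [[]|[]|[]|E _ []]. Qed.

Lemma parent_nonroot Q P : parent Q P -> t1 C P = 0 -> t2 C P = 0 -> False.
Proof. by case=> *; arc_lia. Qed.

Lemma rooted_root D P : rooted D P -> [/\ crit C D, t1 C D = 0 & t2 C D = 0].
Proof. by elim. Qed.

Lemma rooted_minimal D P : rooted D P -> t1 C P = 0 -> t2 C P = 0 -> D = P.
Proof. by case=> // Q {}P qp _ x0 t0; case: (parent_nonroot qp). Qed.

(** Along the four kinds of steps from [Q] to [P], (t_1, h_1, t_2, h_2) changes by (0, -2, 1, 1),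
    (1, 1, 0, -1), (1, -1, 0, 0) and (0, 0, 1, -1). The weights 2, 1, 3, 2 give 3, 1, 1, 1. *)
Lemma parent_measure Q P : parent Q P ->
  2 * t1 C Q + h1 C Q + 3 * t2 C Q + 2 * h2 C Q <
  2 * t1 C P + h1 C P + 3 * t2 C P + 2 * h2 C P.
Proof. by case=> *; arc_lia. Qed.

Lemma parent_exists P : crit C P -> t1 C P = 0 /\ t2 C P = 0 \/
  exists Q, parent Q P.
Proof.
move=> cP; have [[Q qp]|np] := pselect (exists Q, zeroH C Q P).
  by right; exists Q; exact: Parent_zeroH.
have [t10|e] := posnP (t1 C P); last first.
  right; have [Q [qp|qp]] := oneA_or_half cP e; exists Q; first exact: Parent_oneA.
  by apply: Parent_half => // z zp; apply: np; exists z.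
have [t20|e] := posnP (t2 C P); [by left | right].
have [E [ep|ep]] := zeroA_or_zeroH cP e; last by exists E; exact: Parent_zeroH.
by have [Q qe] := zeroA_oneA ep; exists Q; exact: Parent_diag qe ep t10.
Qed.

Lemma rooted_exists P : crit C P -> exists D, rooted D P.
Proof.
move: {-1}(_ + _ + _ + _).+1
  (leqnn (2 * t1 C P + h1 C P + 3 * t2 C P + 2 * h2 C P).+1) => n.
elim: n P => // n IH P ltn cP.
have [[t10 t20]|[Q qp]] := parent_exists cP; first by exists P; constructor.
have [|D DQ] := IH Q _ (parent_crit qp).
  by apply: leq_trans (parent_measure qp) _.
by exists D; apply: Rooted_parent qp DQ.
Qed.

Lemma rooted_step D Q P : parent Q P -> rooted D P <-> rooted D Q.
Proof.
move=> qp; split=> [DP|]; last exact: Rooted_parent.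
case: DP qp => [_ t10 t20 qp|Q' P' qp' DQ' qp].
  by case: (parent_nonroot qp t10 t20).
by rewrite (parent_fun qp qp').
Qed.

Lemma rooted_zeroH D P R : zeroH C P R -> rooted D R <-> rooted D P.
Proof. by move=> pr; apply: rooted_step; exact: Parent_zeroH. Qed.

Lemma rooted_oneA D P R : oneA C P R -> rooted D R <-> rooted D P.
Proof. by move=> pr; apply: rooted_step; exact: Parent_oneA. Qed.

(** If a [zeroH] arc enters [R], the arc is not a step of the descent. A [zeroH] arc then enters [P]
    too, and the square replaces the arc by its opposite side, which starts at a smaller t_2. *)
Lemma rooted_half D P R : half_arc C P R -> rooted D R <-> rooted D P.
Proof.
move: {-1}(t2 C P).+1 (leqnn (t2 C P).+1) => n.
elim: n P R => // n IH P R ltn pr.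
have [[z zr]|nr] := pselect (exists z, zeroH C z R); last first.
  by apply: rooted_step; apply: Parent_half => // z zr; apply: nr; exists z.
have [_ [x [_ _ px]]] := zeroH_half_square zr pr.
have [d [e [dp de er]]] := oneH_half_square px pr.
rewrite (rooted_zeroH D er) (rooted_zeroH D dp); apply: IH => //.
by arc_lia.
Qed.

Lemma rooted_oneH D P R : oneH C P R -> rooted D R <-> rooted D P.
Proof.
move=> pr; have [d [e [dp de er]]] := oneH_half pr.
by rewrite (rooted_half D er) (rooted_half D de) (rooted_zeroH D dp).
Qed.

Lemma zeroH_oneA_out z S P : zeroH C z S -> oneA C S P -> False.
Proof.
by move=> zs sp; have [d [e [sd _ _]]] := zeroH_half zs; arc_clash.
Qed.

(** With [S] before [P] on a [oneA] arc, the passage from [S] to [R] is a step when t_1 = 0 at [S].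
    Otherwise go back from [S]: along a [oneA] arc use the square inside the copy of K(0,A), along
    an arc labelled 1/2 the square to the neighbouring copy. Both lead to a [zeroA] arc starting at
    a smaller t_1. *)
Lemma rooted_zeroA D P R : zeroA C P R -> rooted D R <-> rooted D P.
Proof.
move: {-1}(t1 C P).+1 (leqnn (t1 C P).+1) => n.
elim: n P R => // n IH P R ltn pr.
have [S sp] := zeroA_oneA pr; rewrite (rooted_oneA D sp).
have [s0|e] := posnP (t1 C S).
  by apply: rooted_step; apply: (Parent_diag sp pr); arc_lia.
have [|S' [s's|s's]] := oneA_or_half _ e; first by case: sp.
- have [R' sr'] := oneA_zeroA s's.
  have [R'' r'r'' pr''] := zeroA_oneA_square sr' sp.
  have E : R'' = R by clear -pr pr''; arc_det.
  subst R''; rewrite (rooted_oneA D r'r''); apply: IH sr'.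
  by arc_lia.
- have [||E s'E] := @oneA_or_oneH _ C S'; [by case: s's|by arc_lia|].
  case: s'E => [s'e|s'e]; last first.
    have [d [e' [_ _ e's]]] := oneH_half_square s'e s's.
    by case: (zeroH_oneA_out e's sp).
  have [m [k [c [em sk kc mc]]]] := oneA_half_square s'e s's.
  have E' : k = P by clear -sk sp; arc_det.
  subst k; have E' : c = R by clear -pr kc; arc_det.
  subst c; rewrite (rooted_half D mc) (rooted_half D s's) -(rooted_oneA D s'e).
  by apply: IH em; arc_lia.
Qed.

End Parent.

(** * The four numbers as coordinates of the strings *)

Lemma oneA_oneH_in V (C : crystal V) r d p : oneA C r p -> oneH C d p -> False.
Proof.
move=> [cr _ [y ry yp]] [cd _ [y' [w [dy' y'w wp]]]].
have E : y = w by clear -yp wp; det.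
by subst y; have [v ? ?] := g1_r0_before ry y'w; clash.
Qed.

Lemma zeroA_zeroH_out V (C : crystal V) r d p :
  zeroA C p r -> zeroH C p d -> False.
Proof. by move=> /oneA_dual pr /oneH_dual pd; exact: oneA_oneH_in pr pd. Qed.

(* The invariants (t_1, h_1, t_2, h_2) of a critical vertex; all strings of
   K(H,A) are distinguished by them. *)
Definition sky_coord := (nat * nat * nat * nat)%type.

(* First disjunct: the vertex (k, x) of the copy of K(H,0) with index t - k.
   Second disjunct: the vertex (k, t) of the copy of K(0,A) with index x - k. *)
Definition valid_coord (H A : nat) (c : sky_coord) : Prop :=
  let: (x, y, t, e) := c in
  (exists k, [/\ x + y + k.*2 = H, t + e = A + k.*2, k <= t & k <= e]) \/
  (exists k, [/\ k <= x, k <= y, x + y = H + k.*2 & t + e + k = A]).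

(** The sum x + y is at most H on copies of K(H,0) and at least H on copies of K(0,A), so comparing
    it with H locates the tail. Here this matters because corresponding vertices of neighbouring
    copies of K(0,A) differ by the same vector, with no arc between them off the diagonal. *)
Definition half_step (H : nat) (c c' : sky_coord) : Prop :=
  let: (x, y, t, e) := c in let: (x', y', t', e') := c' in
  [/\ x + y <= H, x' = x.+1, y = y'.+1, t' = t & e' = e].

Definition oneA_step (H : nat) (c c' : sky_coord) : Prop :=
  let: (x, y, t, e) := c in let: (x', y', t', e') := c' in
  [/\ H <= x + y, x' = x.+1, y' = y.+1, t' = t & e = e'.+1].

Definition oneH_step (H : nat) (c c' : sky_coord) : Prop :=
  let: (x, y, t, e) := c in let: (x', y', t', e') := c' in
  [/\ x + y < H, x' = x.+2, y' = y, t = t'.+1 & e = e'.+1].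

Definition zeroA_step (H : nat) (c c' : sky_coord) : Prop :=
  let: (x, y, t, e) := c in let: (x', y', t', e') := c' in
  [/\ H < x + y, x = x'.+1, y = y'.+1, t' = t.+1 & e' = e].

Definition zeroH_step (H : nat) (c c' : sky_coord) : Prop :=
  let: (x, y, t, e) := c in let: (x', y', t', e') := c' in
  [/\ x + y <= H, x' = x, y = y'.+2, t' = t.+1 & e' = e.+1].

Definition coord_arc (H : nat) (a : rat) (c c' : sky_coord) : Prop :=
  [\/ a = 2^-1%R /\ half_step H c c',
      a = 1%R /\ (oneA_step H c c' \/ oneH_step H c c')
    | a = 0%R /\ (zeroA_step H c c' \/ zeroH_step H c c')].

Section Coordinates.
Variables (V : Type) (C : crystal V) (D : V).

Definition coords (P : V) : sky_coord := (t1 C P, h1 C P, t2 C P, h2 C P).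

(** Couples the numerical place of [P] with the kind of arc entering it: the numbers give the range,
    and the arc excludes the other kinds of arcs at [P]. *)
Variant region (P : V) : Prop :=
| Inner z k of zeroH C z P & 0 < k & t1 C P + h1 C P + k.*2 = h1 C D &
    t2 C P + h2 C P = h2 C D + k.*2 & k <= t2 C P & k <= h2 C P
| Outer z k of oneA C z P & 0 < k & k <= t1 C P & k <= h1 C P &
    t1 C P + h1 C P = h1 C D + k.*2 & t2 C P + h2 C P + k = h2 C D
| Diagonal of (forall z, ~ zeroH C z P) & (forall z, ~ oneA C z P) &
    t1 C P + h1 C P = h1 C D & t2 C P + h2 C P = h2 C D.

(** Follow the descent upwards: a [zeroH] step raises the row in a copy of K(H,0), a [oneA] step the
    row in a copy of K(0,A), and the other two steps stay on the diagonal. The remaining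
    combinations are excluded by incompatible arcs. *)
Lemma rooted_region P : rooted C D P -> region P.
Proof.
elim=> [cD x0 t0|Q {}P qp _ regQ].
  by apply: Diagonal => [z|z||]; [move=> zD; arc_lia..|rewrite x0|rewrite t0].
case: qp => [qp|qp|qp np|E qe ep x0]; case: regQ.
- by move=> z k *; apply: (@Inner _ Q k.+1) => //; arc_lia.
- move=> z k zq *; have [r qr] := oneA_zeroA zq.
  by case: (zeroA_zeroH_out qr qp).
- by move=> *; apply: (@Inner _ Q 1) => //; arc_lia.
- by move=> z k zq; case: (zeroH_oneA_out zq qp).
- by move=> z k *; apply: (@Outer _ Q k.+1) => //; arc_lia.
- by move=> *; apply: (@Outer _ Q 1) => //; arc_lia.
- move=> z k zq *; have [x [_ [qx _ _]]] := zeroH_half zq.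
  by have [d [e [_ _ /np]]] := oneH_half_square qx qp.
- by move=> z k zq *; have [r qr] := oneA_zeroA zq; arc_clash.
- move=> *; apply: Diagonal => // [z zp||]; [arc_clash|arc_lia..].
- by move=> z k zq; case: (zeroH_oneA_out zq qe).
- move=> z k zq *; have [r qr] := oneA_zeroA zq.
  have [c rc ec] := zeroA_oneA_square qr qe; exfalso.
  have E' : c = P by clear -ec ep; arc_det.
  by subst c; arc_lia.
- by move=> *; apply: Diagonal => [z zp|z zp||]; [arc_clash|arc_lia..].
Qed.

Lemma region_valid P : region P -> valid_coord (h1 C D) (h2 C D) (coords P).
Proof.
by case=> [z k *|z k *|*]; [left; exists k|right; exists k|left; exists 0];
  split; lia.
Qed.

Lemma half_coord P R : region P -> half_arc C P R ->
  half_step (h1 C D) (coords P) (coords R).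
Proof.
move=> reg pr; suff le_H : t1 C P + h1 C P <= h1 C D by split; arc_lia.
case: reg => [z k ? *|z k zp *|*]; try by lia.
by have [r qr] := oneA_zeroA zp; arc_clash.
Qed.

Lemma oneA_coord P R : region P -> oneA C P R ->
  oneA_step (h1 C D) (coords P) (coords R).
Proof.
move=> reg pr; suff ge_H : h1 C D <= t1 C P + h1 C P by split; arc_lia.
case: reg => [z k zp *|z k zp *|*]; try by lia.
by case: (zeroH_oneA_out zp pr).
Qed.

Lemma oneH_coord P R : region P -> oneH C P R ->
  oneH_step (h1 C D) (coords P) (coords R).
Proof.
move=> reg pr; suff lt_H : t1 C P + h1 C P < h1 C D by split; arc_lia.
have [d [_ [dp _ _]]] := oneH_half pr.
case: reg => [z k zp *|z k zp *|np *]; first by lia.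
  by case: (zeroH_oneA dp zp).
by case: (np d).
Qed.

Lemma zeroA_coord P R : region P -> zeroA C P R ->
  zeroA_step (h1 C D) (coords P) (coords R).
Proof.
move=> reg pr; suff gt_H : h1 C D < t1 C P + h1 C P by split; arc_lia.
have [s sp] := zeroA_oneA pr.
case: reg => [z k zp *|z k zp *|_ np *]; last by case: (np s).
  by case: (zeroH_oneA zp sp).
by lia.
Qed.

Lemma zeroH_coord P R : region P -> zeroH C P R ->
  zeroH_step (h1 C D) (coords P) (coords R).
Proof.
move=> reg pr; suff le_H : t1 C P + h1 C P <= h1 C D by split; arc_lia.
case: reg => [z k zp *|z k zp *|_ np *]; try by lia.
by have [r qr] := oneA_zeroA zp; case: (zeroA_zeroH_out qr pr).
Qed.

Lemma half_out P : crit C P -> region P -> t1 C P + h1 C P <= h1 C D ->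
  0 < h1 C P -> exists R, half_arc C P R.
Proof.
move=> cP reg le_H e; have [R [pr|]] := half_or_zeroA cP e; last by exists R.
by have := zeroA_coord reg pr; case; lia.
Qed.

Lemma zeroH_out P : crit C P -> region P -> t1 C P + h1 C P <= h1 C D ->
  1 < h1 C P -> exists R, zeroH C P R.
Proof.
move=> cP reg le_H e; have [|R pr] := half_out cP reg le_H; first by lia.
exact: half_zeroH pr e.
Qed.

Lemma oneA_out P : crit C P -> region P -> h1 C D <= t1 C P + h1 C P ->
  0 < h2 C P -> exists R, oneA C P R.
Proof.
move=> cP reg ge_H e; have [R [|pr]] := oneA_or_oneH cP e; first by exists R.
by have := oneH_coord reg pr; case; lia.
Qed.

Lemma oneH_out P : region P -> t1 C P + h1 C P < h1 C D ->
  exists R, oneH C P R.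
Proof.
case=> [z k zp *|*|*]; try by lia.
by have [R [_ [pr _ _]]] := zeroH_half zp; exists R.
Qed.

Lemma zeroA_out P : region P -> h1 C D < t1 C P + h1 C P ->
  exists R, zeroA C P R.
Proof. by case=> [z k zp *|z k zp *|*]; try lia; exact: oneA_zeroA zp. Qed.

(** The comparison of x + y with H and, on the diagonal, the vanishing of t_1 decide the kind of
    step; so vertices with equal coordinates descend by the same kind. *)
Lemma parent_cases Q P : region P -> parent C Q P ->
  [\/ zeroH C Q P /\ t1 C P + h1 C P < h1 C D,
      oneA C Q P /\ h1 C D < t1 C P + h1 C P,
      [/\ half_arc C Q P, t1 C P + h1 C P = h1 C D & 0 < t1 C P]
    | [/\ exists2 E, oneA C Q E & zeroA C E P, t1 C P + h1 C P = h1 C D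
        & t1 C P = 0]].
Proof.
move=> reg [qp|qp|qp np|E qe ep x0].
- apply: Or41; split=> //; case: reg => [|z k zp|nz]; first by lia.
    by case: (zeroH_oneA qp zp).
  by case: (nz Q).
- apply: Or42; split=> //; case: reg => [z k zp|z k zp|_ nz]; last by case: (nz Q).
    by case: (zeroH_oneA zp qp).
  by lia.
- apply: Or43; split=> //; last by arc_lia.
  by case: reg => [z k /np//|z k zp|]; first by arc_clash.
- apply: Or44; split=> //; first by exists E.
  by case: reg => [z k zp|z k zp|//]; [arc_clash | lia].
Qed.

Lemma coords_inj P R : rooted C D P -> rooted C D R -> coords P = coords R ->
  P = R.
Proof.
move=> rP; elim: rP R => [cD x0 t0|Q {}P qp rQ IH] R.
  case=> // Q {}R qr _ [? ? ? ?]; case: (parent_nonroot qr); lia.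
move=> rR [eqx eqy eqt eqe].
have := parent_cases (rooted_region (Rooted_parent qp rQ)) qp.
have regR := rooted_region rR.
case: rR eqx eqy eqt eqe regR => [_ x0 t0|Q' {}R qr rQ'] eqx eqy eqt eqe regR.
  by case: (parent_nonroot qp); lia.
have := parent_cases regR qr.
have same_parent : coords Q = coords Q' -> Q = Q' by apply: IH.
case=> [[qr' ?]|[qr' ?]|[qr' ? ?]|[[E' qe' er] ? ?]];
  case=> [[qp' ?]|[qp' ?]|[qp' ? ?]|[[E qe ep] ? ?]]; try lia;
  (have E0 : Q = Q' by apply: same_parent; congr (_, _, _, _); arc_lia);
  subst Q'; clear -qr' qp' || clear -qe' er qe ep; arc_det.
Qed.

(** Any other valid quadruple is one step of the descent above a valid one of smaller weight; the
    region of the vertex found there provides the required arcs. *)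
Lemma coords_onto c : crit C D -> t1 C D = 0 -> t2 C D = 0 ->
  valid_coord (h1 C D) (h2 C D) c -> exists2 P, rooted C D P & coords P = c.
Proof.
move=> cD x0 t0; move: c => [[[x y] t] e].
move: {-1}(_ + _ + _ + _).+1 (leqnn (2 * x + y + 3 * t + 2 * e).+1) => n.
elim: n x y t e => // n IH x y t e ltn val.
have step x' y' t' e' : 2 * x' + y' + 3 * t' + 2 * e' < 2 * x + y + 3 * t + 2 * e ->
    valid_coord (h1 C D) (h2 C D) (x', y', t', e') ->
    exists Q, [/\ rooted C D Q, crit C Q, region Q & coords Q = (x', y', t', e')].
  move=> lt_n val'; have [|Q rQ eqQ] := IH x' y' t' e' _ val'; first by lia.
  exists Q; split=> //; [exact: rooted_crit rQ | exact: rooted_region].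
have [xy|xy|xy] := ltngtP (x + y) (h1 C D).
- have [k [k0 eqH eqA kt ke]] : exists k, [/\ 0 < k, x + y + k.*2 = h1 C D,
      t + e = h2 C D + k.*2, k <= t & k <= e].
    by case: val => [[k [? ? ? ?]]|[k [? ? ? ?]]]; [exists k; split; lia | lia].
  have [||Q [rQ cQ gQ [x' y' t' e']]] := step x y.+2 t.-1 e.-1; first by lia.
    by left; exists k.-1; split; lia.
  have [||P qp] := zeroH_out cQ gQ; [lia..|].
  exists P; first by apply: Rooted_parent rQ; exact: Parent_zeroH.
  by congr (_, _, _, _); arc_lia.
- have [k [k0 kx ky eqH eqA]] : exists k, [/\ 0 < k, k <= x, k <= y,
      x + y = h1 C D + k.*2 & t + e + k = h2 C D].
    by case: val => [[k [? ? ? ?]]|[k [? ? ? ?]]]; [lia | exists k; split; lia].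
  have [||Q [rQ cQ gQ [x' y' t' e']]] := step x.-1 y.-1 t e.+1; first by lia.
    by right; exists k.-1; split; lia.
  have [||P qp] := oneA_out cQ gQ; [lia..|].
  exists P; first by apply: Rooted_parent rQ; exact: Parent_oneA.
  by congr (_, _, _, _); arc_lia.
have eqA : t + e = h2 C D.
  by case: val => [[k [? ? ? ?]]|[k [? ? ? ?]]]; lia.
have [x_0|x_gt0] := posnP x; last first.
  have [||Q [rQ cQ gQ [x' y' t' e']]] := step x.-1 y.+1 t e; first by lia.
    by left; exists 0; split; lia.
  have [||P qp] := half_out cQ gQ; [lia..|].
  exists P; last by congr (_, _, _, _); arc_lia.
  by apply/(rooted_half D qp).
have [t_0|t_gt0] := posnP t.
  exists D; first by constructor.
  by congr (_, _, _, _); lia.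
have [||Q [rQ cQ gQ [x' y' t' e']]] := step x y t.-1 e.+1; first by lia.
  by left; exists 0; split; lia.
have [||E qe] := oneA_out cQ gQ; [lia..|].
have [P ep] := oneA_zeroA qe; exists P; last by congr (_, _, _, _); arc_lia.
by apply/(rooted_zeroA D ep)/(rooted_oneA D qe).
Qed.

(** Conversely, the region of [P] provides some arc of this kind, its end has the coordinates of
    [R], and [coords_inj] identifies the two. *)
Lemma half_coordE P R : rooted C D P -> rooted C D R ->
  half_arc C P R <-> half_step (h1 C D) (coords P) (coords R).
Proof.
move=> rP rR; have [gP cP] := (rooted_region rP, rooted_crit rP).
split=> [|[le_H eqx eqy eqt eqe]]; first exact: half_coord.
have [|R' pr] := half_out cP gP le_H; first by lia.
suff <- : R' = R by [].
apply: coords_inj rR _; first exact/(rooted_half D pr).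
by congr (_, _, _, _); arc_lia.
Qed.

Lemma one_coordE P R : rooted C D P -> rooted C D R ->
  oneA C P R \/ oneH C P R <->
  oneA_step (h1 C D) (coords P) (coords R) \/
  oneH_step (h1 C D) (coords P) (coords R).
Proof.
move=> rP rR; have [gP cP] := (rooted_region rP, rooted_crit rP).
split=> [[/(oneA_coord gP)|/(oneH_coord gP)]|
         [[le_H eqx eqy eqt eqe]|[le_H eqx eqy eqt eqe]]]; [by left|by right|..].
- have [|R' pr] := oneA_out cP gP le_H; first by lia.
  suff <- : R' = R by left.
  apply: coords_inj rR _; first exact/(rooted_oneA D pr).
  by congr (_, _, _, _); arc_lia.
- have [R' pr] := oneH_out gP le_H.
  suff <- : R' = R by right.
  apply: coords_inj rR _; first exact/(rooted_oneH D pr).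
  by congr (_, _, _, _); arc_lia.
Qed.

Lemma zero_coordE P R : rooted C D P -> rooted C D R ->
  zeroA C P R \/ zeroH C P R <->
  zeroA_step (h1 C D) (coords P) (coords R) \/
  zeroH_step (h1 C D) (coords P) (coords R).
Proof.
move=> rP rR; have [gP cP] := (rooted_region rP, rooted_crit rP).
split=> [[/(zeroA_coord gP)|/(zeroH_coord gP)]|
         [[le_H eqx eqy eqt eqe]|[le_H eqx eqy eqt eqe]]]; [by left|by right|..].
- have [R' pr] := zeroA_out gP le_H.
  suff <- : R' = R by left.
  apply: coords_inj rR _; first exact/(rooted_zeroA D pr).
  by congr (_, _, _, _); arc_lia.
- have [|R' pr] := zeroH_out cP gP le_H; first by lia.
  suff <- : R' = R by right.
  apply: coords_inj rR _; first exact/(rooted_zeroH D pr).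
  by congr (_, _, _, _); arc_lia.
Qed.

(** * The root is constant on connected components *)

Definition edge (v w : V) : Prop :=
  (r0 C v w \/ r1 C v w) \/ [\/ g0 C v w, gh C v w | g1 C v w].

Lemma rooted_edge v w c c' : edge v w -> crit C c -> crit C c' ->
  ss C v c -> ss C w c' -> rooted C D c <-> rooted C D c'.
Proof.
move=> vw cc cc' vc wc'.
case: vw => [vw|[vw|vw|vw]].
- suff -> : c = c' by [].
  apply: (crit_same vc) => //; apply: ss_trans wc'.
  by case: vw; [exact: ss_r0 | exact: ss_r1].
- have [d vd dP] := g0_arc vw cc' wc'.
  have E : c = d by apply: (crit_same vc vd) => //; case: dP => -[].
  by subst d; case: dP => [/(rooted_zeroA D)|/(rooted_zeroH D)] ->.
- have [d [d' [vd wd' dd']]] := gh_arc vw; have [cd cd' _] := dd'.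
  have -> : c = d by apply: (crit_same vc vd).
  have -> : c' = d' by apply: (crit_same wc' wd').
  by rewrite (rooted_half D dd').
- have [d wd dP] := g1_arc vw cc vc.
  have E : c' = d by apply: (crit_same wc' wd) => //; case: dP => -[].
  by subst d; case: dP => [/(rooted_oneA D)|/(rooted_oneH D)] ->.
Qed.

Lemma rooted_connected v w c c' : clos_refl_sym_trans V edge v w ->
  crit C c -> crit C c' -> ss C v c -> ss C w c' ->
  rooted C D c <-> rooted C D c'.
Proof.
move=> vw; elim: vw c c' =>
  [x y xy|x|x y _ IH|x y z _ IHxy _ IHyz] c c' cc cc' xc yc'.
- exact: rooted_edge xy cc cc' xc yc'.
- by have -> : c = c' by apply: (crit_same xc yc').
- by rewrite (IH c' c).
- have [d cd yd] := crit_exists C y.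
  by rewrite (IHxy c d) // (IHyz d c').
Qed.

End Coordinates.

(** * The same coordinates on K(H,A) *)

Section KhatCoord.
Variables H A : nat.
Local Notation S := (@KH0_diag H).
Local Notation T := (@K0A_diag A).

(** The last two entries are forced by starting from (0, H, 0, A): a [zeroH] arc adds 1 to both, a
    [oneA] arc takes 1 from the fourth, a [zeroA] arc adds 1 to the third. *)
Definition copies_coord (x : copies S T) : sky_coord :=
  match x with
  | inl (g, t) =>
      let: (k, l) := val g in let j := (val (val t)).2 in
      (l, H - k.*2 - l, k + j, k + (A - j))
  | inr (h, s) =>
      let: (k, j) := val h in let l := (val (val s)).2 in
      (k + l, k + (H - l), j, A - k - j)
  end.

Lemma copies_coord_valid x : valid_coord H A (copies_coord x).
Proof.
case: x => [[[[k l] gP] [[[k' j] /= tP] /= /eqP/= t0]]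
           |[[[k j] hP] [[[k' l] /= sP] /= /eqP/= s0]]]; simpl in *.
- by left; exists k; split; lia.
- by right; exists k; split; lia.
Qed.

Lemma copies_coord_KH0 c : valid_coord H A c -> c.1.1.1 + c.1.1.2 <= H ->
  exists g t, copies_coord (inl (g, t)) = c.
Proof.
case: c => [[[x y] t] e] /= val le_H.
have [k [eqH eqA kt ke]] : exists k, [/\ x + y + k.*2 = H, t + e = A + k.*2,
    k <= t & k <= e].
  by case: val => [[k [? ? ? ?]]|[k [? ? ? ?]]]; [exists k | exists 0; split; lia].
have gP : (k <= H./2) && (x <= H - k.*2) by lia.
have tP : (0 <= A) && (t - k <= A - 0) by lia.
exists (exist _ (k, x) gP : KH0_vertex H).
exists (exist T (exist _ (0, t - k) tP : K0A_vertex A) (eqxx _)).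
by rewrite /=; congr (_, _, _, _); lia.
Qed.

Lemma copies_coord_K0A c : valid_coord H A c -> H <= c.1.1.1 + c.1.1.2 ->
  exists h s, copies_coord (inr (h, s)) = c.
Proof.
case: c => [[[x y] t] e] /= val le_H.
have [k [kx ky eqH eqA]] : exists k, [/\ k <= x, k <= y, x + y = H + k.*2 &
    t + e + k = A].
  by case: val => [[k [? ? ? ?]]|[k [? ? ? ?]]]; [exists 0; split; lia | exists k].
have hP : (k <= A) && (t <= A - k) by lia.
have sP : (0 <= H./2) && (x - k <= H - 0.*2) by lia.
exists (exist _ (k, t) hP : K0A_vertex A).
exists (exist S (exist _ (0, x - k) sP : KH0_vertex H) (eqxx _)).
by rewrite /=; congr (_, _, _, _); lia.
Qed.

(** If row k of a copy of K(H,0) and row k' of a copy of K(0,A) share coordinates, then H - 2k = H +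
    2k', so both vertices lie on the diagonals. *)
Lemma glue_relE x y : glue_rel x y <-> copies_coord x = copies_coord y.
Proof.
have glE g t g' t' : @glue_rel _ _ S T (inl (g, t)) (inl (g', t')) =
    (val g == val g') && (val (val t) == val (val t')).
  by rewrite /= xpair_eqE !val_eqE.
have grE h s h' s' : @glue_rel _ _ S T (inr (h, s)) (inr (h', s')) =
    (val h == val h') && (val (val s) == val (val s')).
  by rewrite /= xpair_eqE !val_eqE.
have gE g t h s : (@glue_rel _ _ S T (inl (g, t)) (inr (h, s)) =
    (val g == val (val s)) && (val h == val (val t))).
  by rewrite /= !val_eqE.
have gE' g t h s : (@glue_rel _ _ S T (inr (h, s)) (inl (g, t)) =
    (val g == val (val s)) && (val h == val (val t))).
  by rewrite /= !val_eqE.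
case: x y => [[g t]|[h s]] [[g' t']|[h' s']]; rewrite ?(glE, grE, gE, gE');
  clear glE grE gE gE'.
- case: g t g' t' => [[k l] gP] [[[k1 j] tP] t0] [[k' l'] gP'] [[[k1' j'] tP'] t0'].
  move: (eqP t0) (eqP t0') => /= e0 e0'; simpl in *; rewrite !xpair_eqE.
  by split=> [?|[*]]; [congr (_, _, _, _); lia | lia].
- case: g t h' s' => [[k l] gP] [[[k1 j] tP] t0] [[k' j'] gP'] [[[k1' l'] tP'] t0'].
  move: (eqP t0) (eqP t0') => /= e0 e0'; simpl in *; rewrite !xpair_eqE.
  by split=> [?|[*]]; [congr (_, _, _, _); lia | lia].
- case: g' t' h s => [[k l] gP] [[[k1 j] tP] t0] [[k' j'] gP'] [[[k1' l'] tP'] t0'].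
  move: (eqP t0) (eqP t0') => /= e0 e0'; simpl in *; rewrite !xpair_eqE.
  by split=> [?|[*]]; [congr (_, _, _, _); lia | lia].
- case: h s h' s' => [[k l] gP] [[[k1 j] tP] t0] [[k' l'] gP'] [[[k1' j'] tP'] t0'].
  move: (eqP t0) (eqP t0') => /= e0 e0'; simpl in *; rewrite !xpair_eqE.
  by split=> [?|[*]]; [congr (_, _, _, _); lia | lia].
Qed.

Definition Khat_coord (u : Khat H A) : sky_coord :=
  copies_coord (repr (u : glued S T)).

Lemma Khat_coord_pi x :
  Khat_coord (\pi_{eq_quot (glue_equiv S T)} x)%qT = copies_coord x.
Proof.
apply/glue_relE; rewrite -[glue_rel _ _]/(glue_equiv S T _ _).
by apply/eqmodP; rewrite reprK.
Qed.

Lemma Khat_coord_inj : injective Khat_coord.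
Proof.
move=> u v eq_uv; rewrite -[u]reprK -[v]reprK; apply/eqmodP.
exact/glue_relE.
Qed.

Lemma Khat_coord_valid u : valid_coord H A (Khat_coord u).
Proof. exact: copies_coord_valid. Qed.

Lemma Khat_coord_onto c : valid_coord H A c -> exists u, Khat_coord u = c.
Proof.
move=> val; have [le_H|/ltnW ge_H] := leqP (c.1.1.1 + c.1.1.2) H.
- have [g [t <-]] := copies_coord_KH0 val le_H.
  by eexists; apply: Khat_coord_pi.
- have [h [s <-]] := copies_coord_K0A val ge_H.
  by eexists; apply: Khat_coord_pi.
Qed.

Lemma Khat_vlabelE (u : Khat H A) : vlabel u = (Khat_coord u).1.1.
Proof.
rewrite /= /Khat_vlabel /Khat_coord.
by case: (repr _) => [[[[k l] gP] t]|[[[k j] hP] s]].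
Qed.

Lemma copies_arc_coord a x y : copies_arc a x y ->
  coord_arc H a (copies_coord x) (copies_coord y).
Proof.
case: x y => [[g t]|[h s]] [[g' t']|[h' s']] //= [<-].
- case: g g' t => [[k l] gP] [[k' l'] gP'] [[[k1 j] tP] t0].
  move: (eqP t0) => /= e0; simpl in *.
  case=> -[-> ? ?]; [apply: Or31 | apply: Or33 | apply: Or32]; split=> //.
  + by split; lia.
  + by right; split; lia.
  + by right; split; lia.
- case: h h' s => [[k j] gP] [[k' j'] gP'] [[[k1 l] tP] t0].
  move: (eqP t0) => /= e0; simpl in *.
  case=> -[-> ? ?]; [apply: Or32 | apply: Or33]; split=> //.
  + by left; split; lia.
  + by left; split; lia.
Qed.

Lemma copies_arc_KH0 a g t g' t' (c := copies_coord (inl (g, t)))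
    (c' := copies_coord (inl (g', t'))) :
  [\/ a = 2^-1%R /\ half_step H c c', a = 1%R /\ oneH_step H c c'
     | a = 0%R /\ zeroH_step H c c'] ->
  @copies_arc _ _ S T a (inl (g, t)) (inl (g', t')).
Proof.
rewrite {}/c {}/c'.
case: g t g' t' => [[k l] gP] [[[k1 j] tP] t0] [[k' l'] gP'] [[[k1' j'] tP'] t0'].
move: (eqP t0) (eqP t0') => /= e0 e0' steps; simpl in *.
have [eq_j eq_arc] : j = j' /\ [\/ [/\ a = 2^-1%R, k' = k & l' = l.+1],
    [/\ a = 0%R, k' = k.+1 & l' = l] | [/\ a = 1%R, k = k'.+1 & l' = l.+2]].
  case: steps => -[-> [? ? ? ? ?]]; (split; first by lia).
  - by apply: Or31; split=> //; lia.
  - by apply: Or33; split=> //; lia.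
  - by apply: Or32; split=> //; lia.
by split=> //; apply: val_inj; apply: val_inj => /=; congr (_, _); lia.
Qed.

Lemma copies_arc_K0A a h s h' s' (c := copies_coord (inr (h, s)))
    (c' := copies_coord (inr (h', s'))) :
  a = 1%R /\ oneA_step H c c' \/ a = 0%R /\ zeroA_step H c c' ->
  @copies_arc _ _ S T a (inr (h, s)) (inr (h', s')).
Proof.
rewrite {}/c {}/c'.
case: h s h' s' => [[k j] gP] [[[k1 l] tP] t0] [[k' j'] gP'] [[[k1' l'] tP'] t0'].
move: (eqP t0) (eqP t0') => /= e0 e0' steps; simpl in *.
have [eq_l eq_arc] : l = l' /\ ([/\ a = 1%R, k' = k.+1 & j' = j] \/
    [/\ a = 0%R, k = k'.+1 & j' = j.+1]).
  case: steps => -[-> [? ? ? ? ?]]; (split; first by lia).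
  - by left; split=> //; lia.
  - by right; split=> //; lia.
by split=> //; apply: val_inj; apply: val_inj => /=; congr (_, _); lia.
Qed.

Lemma Khat_arcE a (u v : Khat H A) :
  Defs.arc a u v <-> coord_arc H a (Khat_coord u) (Khat_coord v).
Proof.
split=> [[x [y [-> -> xy]]]|].
  by rewrite !Khat_coord_pi; exact: copies_arc_coord.
have [vu vv] := (Khat_coord_valid u, Khat_coord_valid v).
have glue (x y : copies S T) :
    copies_coord x = Khat_coord u -> copies_coord y = Khat_coord v ->
    copies_arc a x y -> Defs.arc a u v.
  move=> xu yv xy; exists x, y; split=> //; apply: Khat_coord_inj;
  by rewrite Khat_coord_pi.
pose size (c : sky_coord) := c.1.1.1 + c.1.1.2.
have KH0 : size (Khat_coord u) <= H -> size (Khat_coord v) <= H ->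
    [\/ a = 2^-1%R /\ half_step H (Khat_coord u) (Khat_coord v),
        a = 1%R /\ oneH_step H (Khat_coord u) (Khat_coord v)
      | a = 0%R /\ zeroH_step H (Khat_coord u) (Khat_coord v)] ->
    Defs.arc a u v.
  move=> /(copies_coord_KH0 vu)[g [t gu]] /(copies_coord_KH0 vv)[g' [t' gv]].
  by rewrite -gu -gv => /copies_arc_KH0; apply: glue.
have K0A : H <= size (Khat_coord u) -> H <= size (Khat_coord v) ->
    a = 1%R /\ oneA_step H (Khat_coord u) (Khat_coord v) \/
    a = 0%R /\ zeroA_step H (Khat_coord u) (Khat_coord v) ->
    Defs.arc a u v.
  move=> /(copies_coord_K0A vu)[h [s hu]] /(copies_coord_K0A vv)[h' [s' hv]].
  by rewrite -hu -hv => /copies_arc_K0A; apply: glue.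
clear glue.
case: (Khat_coord u) (Khat_coord v) vu vv KH0 K0A => [[[x y] t] e] [[[x' y'] t'] e'].
rewrite /size /= => vu vv KH0 K0A.
case=> [[ea ste]|[ea [ste|ste]]|[ea [ste|ste]]]; case: (ste) => *.
- by apply: KH0; [lia..|apply: Or31].
- by apply: K0A; [lia..|left].
(* The step alone gives x' + y' <= H + 1; validity fixes the parity of x + y relative to H. *)
- have H_ge : x' + y' <= H.
    by case: vu => -[k [? ? ? ?]]; case: vv => -[k' [? ? ? ?]]; lia.
  by apply: KH0; [lia..|apply: Or32].
- have H_le : H <= x' + y'.
    by case: vu => -[k [? ? ? ?]]; case: vv => -[k' [? ? ? ?]]; lia.
  by apply: K0A; [lia..|right].
- by apply: KH0; [lia..|apply: Or33].
Qed.

End KhatCoord.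

(** * Strings, their indices and their edges *)

Lemma infix2E (T : eqType) (s : seq T) v w : uniq s -> v \in s -> w \in s ->
  infix [:: v; w] s = (index w s == (index v s).+1).
Proof.
move=> us vs ws; apply/infixP/eqP => [[s1 [s2 E]]|E].
  move: us; rewrite E cat_uniq /= => /and3P[_ /norP[nv /norP[nw _]]].
  rewrite !inE negb_or => /andP[/andP[neq_vw _] _].
  rewrite !index_cat (negbTE nv) (negbTE nw) /= eqxx (negbTE neq_vw) eqxx.
  by rewrite addn0 addn1.
exists (take (index v s) s), (drop (index v s).+2 s).
rewrite -[LHS](cat_take_drop (index v s)); congr (_ ++ _).
rewrite (drop_nth v) ?index_mem // nth_index //.
by rewrite (drop_nth v) -?E ?index_mem // nth_index.
Qed.

Section Strings.
Variables (V : choiceType) (e : color -> rel V) (K0e : K0 e).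
Implicit Types (i : color) (s : seq V) (v w : V).

Lemma stringP i v : is_string e i (string e i v) /\ v \in string e i v.
Proof.
rewrite /string; have [s ? ?] := K0e i v.
by apply: (@xgetPex _ [::] [set s | is_string e i s /\ v \in s]%classic); exists s.
Qed.

Lemma mem_string i v : v \in string e i v. Proof. by have [] := stringP i v. Qed.

Lemma is_string_string i v : is_string e i (string e i v).
Proof. by have [] := stringP i v. Qed.

Lemma edge_mem i s v w : is_string e i s -> e i v w -> (v \in s) = (w \in s).
Proof.
move=> [_ _ memE _] vw; apply/idP/idP => [vs|ws].
  by apply/(memE v w vs)/rst_step.
by apply/(memE w v ws)/rst_sym/rst_step.
Qed.

Lemma edge_index i s v w : is_string e i s -> v \in s -> w \in s ->
  e i v w = (index w s == (index v s).+1).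
Proof. by move=> [_ us _ eE] vs ws; rewrite eE // infix2E. Qed.

(** Both list the same component, and the edge relation determines indices inductively through the
    predecessor. *)
Lemma string_unique i s s' v : is_string e i s -> is_string e i s' ->
  v \in s -> v \in s' -> s = s'.
Proof.
move=> ss ss' vs vs'.
have [_ us memE _] := ss; have [_ us' memE' _] := ss'.
have eq_mem : s =i s'.
  by move=> w; apply/idP/idP => [/(memE _ _ vs)/(memE' _ _ vs')
                                |/(memE' _ _ vs')/(memE _ _ vs)].
have eq_index n w : w \in s -> index w s = n -> index w s' = n.
  elim: n w => [|n IH] w ws wn; have ws' : w \in s' by rewrite -eq_mem.
    case E : (index w s') => [//|m].
    pose u := nth w s' m.
    have lt_m : m < size s' by rewrite ltnW // -E index_mem.
    have us1 : u \in s' by apply: mem_nth.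
    have um : index u s' = m by rewrite index_uniq.
    have := edge_index ss' us1 ws'; rewrite um E eqxx.
    by rewrite (edge_index ss) ?eq_mem // wn => /esym.
  pose u := nth w s n.
  have lt_n : n < size s by rewrite ltnW // -wn index_mem.
  have us1 : u \in s by apply: mem_nth.
  have un : index u s = n by rewrite index_uniq.
  have := edge_index ss us1 ws; rewrite un wn eqxx.
  by rewrite (edge_index ss') -?eq_mem // (IH _ us1 un) => /eqP.
apply: (@eq_from_nth _ v) => [|j lt_j].
  by apply/perm_size/uniq_perm.
have js : nth v s j \in s by apply: mem_nth.
by rewrite -{2}(index_uniq v lt_j us) -(eq_index _ _ js erefl) nth_index -?eq_mem.
Qed.

Lemma stringE i s v : is_string e i s -> v \in s -> string e i v = s.
Proof.
move=> ss vs.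
exact: string_unique (is_string_string i v) ss (mem_string i v) vs.
Qed.

Lemma string_edge i v w : e i v w -> string e i v = string e i w.
Proof.
move=> vw; apply/esym/stringE; first exact: is_string_string.
by rewrite -(edge_mem (is_string_string i v) vw) mem_string.
Qed.

Lemma t_edge i v w : e i v w -> t e i w = (t e i v).+1.
Proof.
move=> vw; apply/eqP; rewrite /t -(string_edge vw).
rewrite -(edge_index (is_string_string i v)) ?mem_string //.
by rewrite (string_edge vw) mem_string.
Qed.

Lemma t_lt i v : t e i v < size (string e i v).
Proof. by rewrite index_mem mem_string. Qed.

Lemma h_edge i v w : e i v w -> h e i v = (h e i w).+1.
Proof.
move=> vw; have := t_lt i w; rewrite /h (t_edge vw) -(string_edge vw); lia.
Qed.

Lemma th_string i v w : string e i v = string e i w ->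
  t e i v + h e i v = t e i w + h e i w.
Proof. by move=> E; have := (t_lt i v, t_lt i w); rewrite /h E => -[]; lia. Qed.

Lemma t_inj i v w : string e i v = string e i w -> t e i v = t e i w -> v = w.
Proof.
move=> E; rewrite /t -E => eq_t; rewrite -(nth_index v (mem_string i v)) eq_t.
by rewrite nth_index // E mem_string.
Qed.

Lemma h_edge_ex i v : 0 < h e i v -> exists w, e i v w.
Proof.
move=> h0; have lt_s : (t e i v).+1 < size (string e i v).
  by move: h0; rewrite /h; lia.
have [_ us _ _] := is_string_string i v.
exists (nth v (string e i v) (t e i v).+1).
rewrite (edge_index (is_string_string i v)) ?mem_nth ?mem_string //.
by rewrite index_uniq.
Qed.

Lemma t_edge_ex i v : 0 < t e i v -> exists u, e i u v.
Proof.
move=> t0; have lt_s := t_lt i v; have [_ us _ _] := is_string_string i v.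
have lt_s' : (t e i v).-1 < size (string e i v) by lia.
exists (nth v (string e i v) (t e i v).-1).
rewrite (edge_index (is_string_string i v)) ?mem_nth ?mem_string //.
by rewrite index_uniq // prednK.
Qed.

Lemma edge_fun i v w w' : e i v w -> e i v w' -> w = w'.
Proof.
move=> vw vw'; apply: (@t_inj i).
  by rewrite -(string_edge vw) (string_edge vw').
by rewrite (t_edge vw) (t_edge vw').
Qed.

Lemma edge_inj i u u' v : e i u v -> e i u' v -> u = u'.
Proof.
move=> uv u'v; apply: (@t_inj i).
  by rewrite (string_edge uv) (string_edge u'v).
by have := t_edge uv; rewrite (t_edge u'v) => -[].
Qed.

End Strings.

(** * R-graphs satisfy the abstract axioms *)

Section Instance.
Variables (V : choiceType) (e : color -> rel V) (Re : R_graph e).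

Let K0e := R_graph_K0 Re.

(** By (K2) the drop of t_2 and the rise of h_2 are natural numbers, and by (K1) they add up to
    1. *)
Lemma red_edge v w : e red v w ->
  (arr e red 0%R v w /\ t e green v = (t e green w).+1 /\
     h e green v = h e green w) \/
  (arr e red 1%R v w /\ t e green v = t e green w /\
     h e green w = (h e green v).+1).
Proof.
move=> vw; have [/(_ v w vw) K1vw _] := R_graph_K1 Re.
have [/(_ v w vw) [K2t K2h] _] := R_graph_K2 Re.
have [E|E] : h e green w = h e green v \/ h e green w = (h e green v).+1 by lia.
- left; split; last by split; lia.
  by split=> //; rewrite /label E GRing.subrr.
- right; split; last by split; lia.
  by split=> //; rewrite /label E -GRing.natr1 GRing.addrAC GRing.subrr
    GRing.add0r.
Qed.

Lemma green_edge v w : e green v w ->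
  [\/ arr e green 0%R v w /\ t e red v = (t e red w).+2 /\
        h e red v = h e red w,
      arr e green 2^-1%R v w /\ t e red v = (t e red w).+1 /\
        h e red w = (h e red v).+1
    | arr e green 1%R v w /\ t e red v = t e red w /\
        h e red w = (h e red v).+2].
Proof.
move=> vw; have [_ /(_ v w vw) K1vw] := R_graph_K1 Re.
have [_ /(_ v w vw) [K2t K2h]] := R_graph_K2 Re.
have [E|E|E] : [\/ h e red w = h e red v, h e red w = (h e red v).+1
    | h e red w = (h e red v).+2].
  case: (ltngtP (h e red w) (h e red v).+1) => [?|?|->].
  - by apply: Or31; lia.
  - by apply: Or33; lia.
  - exact: Or32.
- apply: Or31; split; last by split; lia.
  by split=> //; rewrite /label E GRing.subrr GRing.mul0r.
- apply: Or32; split; last by split; lia.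
  by split=> //; rewrite /label E -GRing.natr1 GRing.addrAC GRing.subrr
    GRing.add0r GRing.mul1r.
- apply: Or33; split; last by split; lia.
  by split=> //; rewrite /label E -addn2 GRing.natrD GRing.addrAC GRing.subrr
    GRing.add0r GRing.mulfV.
Qed.

Lemma arr_fun i a b v w : arr e i a v w -> arr e i b v w -> a = b.
Proof. by move=> [_ <-] [_ <-]. Qed.

Lemma R_graph_K5_kinds : K5_kinds (arr e red 0%R) (arr e red 1%R)
  (arr e green 0%R) (arr e green 2^-1%R) (arr e green 1%R).
Proof. by have [] := R_graph_K5 Re. Qed.

Lemma R_graph_K5_kinds_dual : K5_kinds
  (fun v w => arr e red 1%R w v) (fun v w => arr e red 0%R w v)
  (fun v w => arr e green 1%R w v) (fun v w => arr e green 2^-1%R w v)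
  (fun v w => arr e green 0%R w v).
Proof.
have half_sub : (1 - 2^-1 = 2^-1 :> rat)%R by [].
have [] := R_graph_K5_dual Re.
rewrite /K5a /K5b /K5c /K5d /dual_arr !GRing.subrr !GRing.subr0 !half_sub.
by split.
Qed.

(** Kept transparent, so that its fields unfold to [arr], [t], [h] and equality of strings. *)
Definition R_graph_crystal : crystal V.
Proof.
apply: (@Crystal V (arr e red 0%R) (arr e red 1%R)
  (arr e green 0%R) (arr e green 2^-1%R) (arr e green 1%R)
  (fun v w => string e red v = string e red w)
  (t e red) (h e red) (t e green) (h e green)).
- move=> v w vw; have [evw _] := vw.
  rewrite (t_edge K0e evw) (h_edge K0e evw).
  by case: (red_edge evw) => -[vw' [? ?]] //; have := arr_fun vw vw'.
- move=> v w vw; have [evw _] := vw.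
  rewrite (t_edge K0e evw) (h_edge K0e evw).
  by case: (red_edge evw) => -[vw' [? ?]] //; have := arr_fun vw vw'.
- move=> v w vw; have [evw _] := vw.
  rewrite (t_edge K0e evw) (h_edge K0e evw).
  by case: (green_edge evw) => -[vw' [? ?]] //; have := arr_fun vw vw'.
- move=> v w vw; have [evw _] := vw.
  rewrite (t_edge K0e evw) (h_edge K0e evw).
  by case: (green_edge evw) => -[vw' [? ?]] //; have := arr_fun vw vw'.
- move=> v w vw; have [evw _] := vw.
  rewrite (t_edge K0e evw) (h_edge K0e evw).
  by case: (green_edge evw) => -[vw' [? ?]] //; have := arr_fun vw vw'.
- move=> v /(h_edge_ex K0e)[w /red_edge[[vw _]|[vw _]]]; exists w; by [left|right].
- move=> v /(t_edge_ex K0e)[w /red_edge[[vw _]|[vw _]]]; exists w; by [left|right].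
- move=> v /(h_edge_ex K0e)[w /green_edge[[vw _]|[vw _]|[vw _]]]; exists w;
    by [apply: Or31|apply: Or32|apply: Or33].
- move=> v /(t_edge_ex K0e)[w /green_edge[[vw _]|[vw _]|[vw _]]]; exists w;
    by [apply: Or31|apply: Or32|apply: Or33].
- by move=> v w w' [[vw _]|[vw _]] [[vw' _]|[vw' _]];
    exact: edge_fun K0e _ _ _ _ vw vw'.
- by move=> u u' v [[uv _]|[uv _]] [[uv' _]|[uv' _]];
    exact: edge_inj K0e _ _ _ _ uv uv'.
- by move=> v w w' [[vw _]|[vw _]|[vw _]] [[vw' _]|[vw' _]|[vw' _]];
    exact: edge_fun K0e _ _ _ _ vw vw'.
- by move=> u u' v [[uv _]|[uv _]|[uv _]] [[uv' _]|[uv' _]|[uv' _]];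
    exact: edge_inj K0e _ _ _ _ uv uv'.
- by [].
- by [].
- by move=> u v w ->.
- by move=> v w [/(string_edge K0e)].
- by move=> v w [/(string_edge K0e)].
- exact: t_inj.
- exact: th_string.
- by move=> u v w uv vw; have := R_graph_K3 Re uv vw.
- move=> u v w uv.
  have [K4r _] := R_graph_K4 Re.
  by case=> vw; have [neq lt_ab] := K4r _ _ _ _ _ uv vw;
    [case: neq | case: lt_ab | case: lt_ab => // _ _ [y [? ?]]];
    split=> //; exists y.
- move=> u v w uv vw.
  have [_ K4g] := R_graph_K4 Re.
  by case: uv => uv; have [neq lt_ab] := K4g _ _ _ _ _ uv vw;
    [case: lt_ab => // _ _ [y [? ?]] | case: lt_ab | case: neq];
    split=> //; exists y.
- by move=> u v w uv vw; have [K4r _] := R_graph_K4 Re; case: (K4r _ _ _ _ _ uv vw).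
- by move=> u v w uv vw; have [_ K4g] := R_graph_K4 Re; case: (K4g _ _ _ _ _ uv vw).
- exact: R_graph_K5_kinds.
- exact: R_graph_K5_kinds_dual.
Defined.

End Instance.

(** * The view from the sky in terms of critical vertices *)

Section Sky.
Variables (V : choiceType) (e : color -> rel V) (Re : R_graph e).
Let C := R_graph_crystal Re.
Let K0e := R_graph_K0 Re.
Implicit Types (S : red_string e) (c v w : V).

Lemma red_stringP S : is_string e red (val S).
Proof. exact/asboolP/(valP S). Qed.

Lemma red_string_ss S v w : v \in val S -> ss C v w <-> w \in val S.
Proof.
move=> vS; rewrite /= (stringE K0e (red_stringP S) vS).
split=> [->|wS]; first exact: mem_string K0e _ _.
by rewrite (stringE K0e (red_stringP S) wS).
Qed.

Lemma red_string_crit S : exists2 c, crit C c & c \in val S.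
Proof.
have [] := red_stringP S; case E : (val S) => [//|v s] _ _ _ _.
have vS : v \in val S by rewrite E mem_head.
have [c cc vc] := crit_exists C v.
by exists c => //; rewrite -E; apply/(red_string_ss c vS).
Qed.

Lemma red_string_edge S v w : e red v w -> (v \in val S) = (w \in val S).
Proof. exact: edge_mem (red_stringP S). Qed.

Lemma sky_arcE a S S' c c' : crit C c -> crit C c' ->
  c \in val S -> c' \in val S' ->
  sky_arc a S S' <->
  [\/ a = 2^-1%R /\ half_arc C c c',
      a = 1%R /\ (oneA C c c' \/ oneH C c c')
    | a = 0%R /\ (zeroA C c c' \/ zeroH C c c')].
Proof.
move=> cc cc' cS cS'; split=> [[x [y [xS yS xy]]]|].
  have [_ xc] := red_string_ss c xS; have {}xc := xc cS.
  have [_ yc'] := red_string_ss c' yS; have {}yc' := yc' cS'.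
  have [exy _] := xy.
  case: (green_edge Re exy) => -[xy' _].
  - rewrite (arr_fun xy xy'); apply: Or33; split=> //.
    have [d xd dP] := @g0_arc _ C _ _ _ xy' cc' yc'.
    by have -> : c = d by apply: crit_same xc xd _ _ => //; case: dP => -[].
  - rewrite (arr_fun xy xy'); apply: Or31; split=> //.
    have [d [d' [xd yd' dd']]] := @gh_arc _ C _ _ xy'; have [cd cd' _] := dd'.
    by rewrite (crit_same xc xd cc cd) (crit_same yc' yd' cc' cd').
  - rewrite (arr_fun xy xy'); apply: Or32; split=> //.
    have [d yd dP] := @g1_arc _ C _ _ _ xy' cc xc.
    by have -> : c' = d by apply: crit_same yc' yd _ _ => //; case: dP => -[].
have memE v w : r0 C v w \/ r1 C v w -> (v \in val S) = (w \in val S).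
  by case=> -[vw _]; exact: red_string_edge.
have memE' v w : r0 C v w \/ r1 C v w -> (v \in val S') = (w \in val S').
  by case=> -[vw _]; exact: red_string_edge.
case=> -[->].
- move=> [_ _ [p [q [cp pq qc']]]]; exists p, q; split=> //.
    by rewrite -(memE c p) //; right.
  by rewrite (memE' q c') //; left.
- case=> [[_ _ [y cy yc']]|[_ _ [y [w [cy yw wc']]]]]; exists c, y; split=> //.
    by rewrite (memE' y c') //; left.
  by rewrite (memE' y w) ?(memE' w c') //; left.
- case=> [[_ _ [p cp pc']]|[_ _ [p [q [cp pq qc']]]]].
    exists p, c'; split=> //.
    by rewrite -(memE c p) //; right.
  exists q, c'; split=> //.
  by rewrite -(memE p q) -?(memE c p) //; right.
Qed.

Lemma crit_critical S c : crit C c -> c \in val S -> critical e (val S) c.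
Proof.
move=> cc cS; split=> // x y xy.
have xS : x \in val S by apply: (mem_infix xy); rewrite mem_head.
have yS : y \in val S by apply: (mem_infix xy); rewrite inE mem_head orbT.
have [_ _ _ eE] := red_stringP S; have exy : e red x y by rewrite eE.
have tE v : v \in val S -> index v (val S) = t e red v.
  by move=> vS; rewrite /t (stringE K0e (red_stringP S) vS).
rewrite !tE // (t_edge K0e exy).
have cx : ss C c x by apply/(red_string_ss x cS).
have cy : ss C c y by apply/(red_string_ss y cS).
case: (red_edge Re exy) => -[xy' _].
  split=> [_|le_cx]; first by case: xy'.
  have := @r1_crit_le _ (dual C) c y x.
  move=> /(_ (proj2 (crit_dual C c) cc) cy xy') /=.
  by have := th_string K0e cy; have := t_edge K0e exy; lia.
split=> [lt_xc|_]; last by case: xy'.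
by have /= := @r1_crit_le _ C c x y cc cx xy'; lia.
Qed.

Lemma critical_crit S c : critical e (val S) c -> crit C c.
Proof.
move=> [cS lab]; have [_ _ _ eE] := red_stringP S.
split=> [u [uc l1]|w [cw l0]].
  have uS : u \in val S by rewrite (red_string_edge S uc).
  have inf_uc : infix [:: u; c] (val S) by rewrite -eE.
  by have [/(_ (leqnn _)) l0 _] := lab u c inf_uc; rewrite l0 in l1.
have wS : w \in val S by rewrite -(red_string_edge S cw).
have inf_cw : infix [:: c; w] (val S) by rewrite -eE.
by have [_ /(_ (leqnn _)) l1] := lab c w inf_cw; rewrite l1 in l0.
Qed.

Lemma sky_vlabelE S c : crit C c -> c \in val S ->
  sky_vlabel S = (t e red c, h e red c).
Proof.
move=> cc cS; rewrite /sky_vlabel.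
have [|d dS ->] := @xgetPex _ (0, 0) [set xy | exists2 c, critical e (val S) c &
    xy = (t e red c, h e red c)]%classic.
  by exists (t e red c, h e red c), c => //; exact: crit_critical.
have dSS : d \in val S by case: dS.
suff -> : c = d by [].
by apply: crit_unique cc (critical_crit dS) _; apply/(red_string_ss d cS).
Qed.

End Sky.

Theorem proposition1 (V : choiceType) (e : color -> rel V) :
  R_graph e -> weakly_connected e ->
  exists s : V,
    unique (source e) s /\ lgraph_iso (sky e) (Khat (h e red s) (h e green s)).
Proof.
move=> Re [[v0] conn]; pose C := R_graph_crystal Re; have K0e := R_graph_K0 Re.
have [c0 cc0 vc0] := crit_exists C v0; have [D rD0] := rooted_exists cc0.
(* Connectedness gives all critical vertices the same root [D]. *)
have rD c : crit C c -> rooted C D c.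
  move=> cc; suff c0c : clos_refl_sym_trans V (edge C) c0 c.
    by apply/(rooted_connected D c0c cc0 cc (ss_refl C c0) (ss_refl C c)).
  elim: (conn c0 c) => [x y|x|x y _ IH|x y z _ IHxy _ IHyz].
  - move=> /orP[xy|xy]; apply: rst_step.
      by left; case: (red_edge Re xy) => -[xy' _]; [left|right].
    by right; case: (green_edge Re xy) => -[xy' _];
      [apply: Or31|apply: Or32|apply: Or33].
  - exact: rst_refl.
  - exact: rst_sym.
  - exact: rst_trans IHxy IHyz.
have [cD x0 t0] := rooted_root rD0.
exists D; split; first split.
- move=> i v; apply/negP => vD; have := t_edge K0e vD.
  by case: i vD => _; [rewrite [t e red D]x0 | rewrite [t e green D]t0].
- move=> s src.
  have s0 i : t e i s = 0.
    apply/eqP; rewrite -leqn0 leqNgt; apply/negP => /(t_edge_ex K0e)[u us].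
    by have := src i u; rewrite us.
  (* No edge enters [s], and a red edge labelled 0 leaving [s] would lower t_2, which is already
     0. *)
  have cs : crit C s.
    split=> [u [us _]|w sw]; first by have := src red u; rewrite us.
    by have [_ _ + _] := r0_stat sw; rewrite /= s0.
  exact: rooted_minimal (rD s cs) (s0 red) (s0 green).
have Khat_ex (S : red_string e) : exists u : Khat (h e red D) (h e green D),
    exists c, [/\ crit C c, c \in val S & Khat_coord u = coords C c].
  have [c cc cS] := red_string_crit Re S.
  have [u uc] := Khat_coord_onto (region_valid (rooted_region (rD c cc))).
  by exists u, c.
have [f fP] := boolp.choice Khat_ex.
have f_inj : injective f.
  move=> S S' ff; have [c [cc cS fc]] := fP S; have [c' [cc' cS' fc']] := fP S'.
  have E : c = c' by apply: coords_inj (rD c cc) (rD c' cc') _; rewrite -fc -fc' ff.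
  apply: val_inj; subst c'.
  exact: string_unique (red_stringP S) (red_stringP S') cS cS'.
have f_onto u : exists S, f S = u.
  have [P rP Pu] := coords_onto cD x0 t0 (Khat_coord_valid u).
  have PP : `[< is_string e red (string e red P) >].
    exact/asboolP/is_string_string.
  pose S : red_string e := exist _ (string e red P) PP.
  exists S; apply: Khat_coord_inj.
  have [c [cc cS ->]] := fP S; rewrite -Pu.
  suff -> : c = P by [].
  apply: crit_unique cc (rooted_crit rP) _.
  by apply/(red_string_ss Re P cS); exact: mem_string.
have [g gK] := boolp.choice f_onto.
exists f; split.
- by exists g => // S; apply: f_inj; rewrite gK.
- move=> a S S'; have [c [cc cS fc]] := fP S; have [c' [cc' cS' fc']] := fP S'.
  apply: (iff_trans (sky_arcE a cc cc' cS cS')); rewrite Khat_arcE fc fc'.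
  have [rc rc'] := (rD c cc, rD c' cc').
  rewrite (propext (half_coordE rc rc')) (propext (one_coordE rc rc')).
  by rewrite (propext (zero_coordE rc rc')).
- move=> S; have [c [cc cS fc]] := fP S.
  by rewrite Khat_vlabelE fc; apply/esym/(sky_vlabelE cc cS).
Qed.
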